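(* Let $D=D_1\cup\dots\cup D_p\subset(\mathbb{C}^2,0)$ be the germ of a reduced plane curve with irreducible components $D_1,\dots,D_p$. The conductor of the module of logarithmic residues $\mathcal{R}_D$, that is, the minimal $\nu\in\mathbb{Z}^p$ (for the product order) such that $\nu+\mathbb{N}^p\subseteq\mathrm{val}(\mathcal{R}_D)$, is $$-(m^{(1)},\dots,m^{(p)})+\underline{1},$$ where $m^{(j)}=\inf(\mathrm{val}_j(x),\mathrm{val}_j(y))$ is the multiplicity of the component $D_j$ of $D$.
   Context: Let $f\in\mathbb{C}\{x,y\}$ be a reduced equation of $D$, $\mathcal{O}_D=\mathbb{C}\{x,y\}/(f)$, with normalization $\mathcal{O}_{\widetilde D}=\bigoplus_{i=1}^p\mathbb{C}\{t_i\}$ and total ring of fractions $Q(\mathcal{O}_D)=\bigoplus_iQ(\mathbb{C}\{t_i\})$. For $g\in Q(\mathcal{O}_D)$, $\mathrm{val}_i(g)\in\mathbb{Z}\cup\{\infty\}$ is the order in $t_i$ of its $i$-th component and $\mathrm{val}(g)=(\mathrm{val}_1(g),\dots,\mathrm{val}_p(g))$. For an $\mathcal{O}_D$-submodule $I\subset Q(\mathcal{O}_D)$, $\mathrm{val}(I)\subset\mathbb{Z}^p$ is the set of values of the non zero divisors in $I$. $\underline{1}=(1,\dots,1)$. $\Omega^1(\log D)$ is the module of germs of meromorphic $1$-forms $\omega$ on $(\mathbb{C}^2,0)$ such that $f\omega$ and $f\,\mathrm{d}\omega$ are holomorphic. For every such $\omega$ there exist $g,\xi\in\mathbb{C}\{x,y\}$,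 with $g$ inducing a non zero divisor in $\mathcal{O}_D$, and a holomorphic $1$-form $\eta$, such that $g\omega=\xi\frac{\mathrm{d}f}{f}+\eta$; the logarithmic residue is $\mathrm{res}(\omega)=\frac{\xi}{g}\big|_D\in Q(\mathcal{O}_D)$ (well defined). $\mathcal{R}_D=\{\mathrm{res}(\omega):\omega\in\Omega^1(\log D)\}$. *)

(* Defs.v *)
From HB Require Import structures.
From mathcomp Require Import all_boot all_order all_algebra.
From mathcomp Require Import complex.
From mathcomp Require Import boolp reals constructive_ereal.

Set Implicit Arguments.
Unset Strict Implicit.
Unset Printing Implicit Defensive.

Import Order.TTheory GRing.Theory Num.Theory.
Local Open Scope ring_scope.

(* Formal power series R[[t]].  Iterating the construction gives two
   variables: a : fps (fps R) is the sum of the (a i j) x^i y^j. *)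

Record fps (R : Type) := Fps { coefs :> nat -> R }.

Lemma fpsP (R : Type) (a b : fps R) : a =1 b -> a = b.
Proof. by case: a b => [a] [b] /= ab; congr Fps; apply/funext. Qed.

HB.instance Definition _ (R : Type) := gen_eqMixin (fps R).
HB.instance Definition _ (R : Type) := gen_choiceMixin (fps R).

Section FpsRing.
Variable R : comNzRingType.
Implicit Types a b c : fps R.

Definition fpsC (c : R) : fps R := Fps (fun n => if n is 0%N then c else 0).
Definition fpsX : fps R := Fps (fun n => if n is 1%N then 1 else 0).
Definition fps_add a b : fps R := Fps (fun n => a n + b n).
Definition fps_opp a : fps R := Fps (fun n => - a n).
Definition fps_mul a b : fps R :=
  Fps (fun n => \sum_(i < n.+1) a i * b (n - i)%N).
Definition fps_deriv a : fps R := Fps (fun n => a n.+1 *+ n.+1).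

Fact fps_addA : associative fps_add.
Proof. by move=> a b c; apply: fpsP => n /=; rewrite addrA. Qed.
Fact fps_addC : commutative fps_add.
Proof. by move=> a b; apply: fpsP => n /=; rewrite addrC. Qed.
Fact fps_add0 : left_id (fpsC 0) fps_add.
Proof. by move=> a; apply: fpsP => -[|n] /=; rewrite add0r. Qed.
Fact fps_addN : left_inverse (fpsC 0) fps_opp fps_add.
Proof. by move=> a; apply: fpsP => -[|n] /=; rewrite addNr. Qed.

HB.instance Definition _ :=
  GRing.isZmodule.Build (fps R) fps_addA fps_addC fps_add0 fps_addN.

Let trunc n a : {poly R} := \poly_(i < n) a i.

Let fps_mul_trunc n a b i : (i < n)%N ->
  fps_mul a b i = (trunc n a * trunc n b)`_i.
Proof.
move=> lin; rewrite coefM /=; apply: eq_bigr => j _.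
have lji : (j <= i)%N by rewrite -ltnS.
by rewrite !coef_poly (leq_ltn_trans lji lin) (leq_ltn_trans (leq_subr _ _) lin).
Qed.

Fact fps_mulA : associative fps_mul.
Proof.
move=> a b c; apply: fpsP => n.
transitivity ((trunc n.+1 a * (trunc n.+1 b * trunc n.+1 c))`_n).
  rewrite coefM /=; apply: eq_bigr => j _.
  rewrite -[\sum_(_ < _) _]/(fps_mul b c (n - j)%N) (@fps_mul_trunc n.+1).
    by rewrite coef_poly ltn_ord.
  by rewrite ltnS leq_subr.
rewrite mulrA coefM /=; apply: eq_bigr => j _.
rewrite -[\sum_(_ < _) _]/(fps_mul a b j) (@fps_mul_trunc n.+1) //.
by rewrite coef_poly ltnS leq_subr.
Qed.

Fact fps_mulC : commutative fps_mul.
Proof.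
move=> a b; apply: fpsP => n.
by rewrite !(@fps_mul_trunc n.+1) // mulrC.
Qed.

Fact fps_mul1 : left_id (fpsC 1) fps_mul.
Proof.
move=> a; apply: fpsP => n /=; rewrite big_ord_recl /= mul1r subn0.
by rewrite big1 ?addr0 // => i _; rewrite mul0r.
Qed.

Fact fps_mulDl : left_distributive fps_mul fps_add.
Proof.
move=> a b c; apply: fpsP => n /=; rewrite -big_split /=.
by apply: eq_bigr => i _; rewrite mulrDl.
Qed.

Fact fps_1neq0 : fpsC 1 != fpsC 0.
Proof.
by apply/eqP => /(congr1 (fun a => coefs a 0%N)) /= /eqP; rewrite oner_eq0.
Qed.

HB.instance Definition _ := GRing.Zmodule_isComNzRing.Build (fps R)
  fps_mulA fps_mulC fps_mul1 fps_mulDl fps_1neq0.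

Lemma fps0E n : (0 : fps R) n = 0. Proof. by case: n. Qed.

Lemma fps_exN0 a : a <> 0 -> exists n, a n != 0.
Proof.
move=> a0; apply/not_existsP => h; apply: a0; apply: fpsP => n.
by have /negP/negPn/eqP -> := h n; case: n.
Qed.

Lemma fps_integral :
    (forall u v : R, u * v = 0 -> u = 0 \/ v = 0) ->
  forall a b, a * b = 0 -> a = 0 \/ b = 0.
Proof.
move=> RI a b ab0; apply: contrapT => /not_orP[/fps_exN0 ea /fps_exN0 eb].
case: (ex_minnP ea) => m am ma; case: (ex_minnP eb) => n bn nb.
have := congr1 (fun c => coefs c (m + n)%N) ab0.
have -> : (0 : fps R) (m + n)%N = 0 by case: (m + n)%N.
have mlt : (m < (m + n).+1)%N by rewrite ltnS leq_addr.
rewrite /= (bigD1 (Ordinal mlt)) //= addKn big1.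
  by rewrite addr0 => /RI[]/eqP; [rewrite (negPf am)|rewrite (negPf bn)].
move=> i; rewrite -val_eqE /= => im.
case: (ltngtP i m) im => // im _.
  have [->|ai] := eqVneq (a i) 0; first by rewrite mul0r.
  by have := ma _ ai; rewrite leqNgt im.
have [->|bi] := eqVneq (b (m + n - i)%N) 0; first by rewrite mulr0.
have := nb _ bi; rewrite leq_subRL; last by rewrite -ltnS ltn_ord.
by rewrite leq_add2r leqNgt im.
Qed.

End FpsRing.

Definition fps_dx (R : comNzRingType) (a : fps (fps R)) : fps (fps R) :=
  fps_deriv a.
Definition fps_dy (R : comNzRingType) (a : fps (fps R)) : fps (fps R) :=
  Fps (fun i => fps_deriv (a i)).

Section Weight.
Variable C : numFieldType.

Record submult (A : comNzRingType) (N : A -> C) : Prop := Submult {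
  sm_ge0 : forall a, 0 <= N a;
  sm_0 : N 0 = 0;
  sm_1 : N 1 <= 1;
  sm_N : forall a, N (- a) = N a;
  sm_D : forall a b, N (a + b) <= N a + N b;
  sm_M : forall a b, N (a * b) <= N a * N b }.

Definition wsum (A : Type) (N : A -> C) (r : C) (n : nat) (a : fps A) : C :=
  \sum_(i < n) N (a i) * r ^+ i.

Lemma submult_norm : submult (fun z : C => `|z|).
Proof.
split; [exact: normr_ge0 | exact: normr0 | by rewrite normr1 | exact: normrN
  | exact: ler_normD | by move=> a b; rewrite normrM].
Qed.

Variables (A : comNzRingType) (N : A -> C) (r : C).
Hypotheses (NP : submult N) (r_gt0 : 0 < r).

Let r_ge0 k : 0 <= r ^+ k. Proof. by rewrite exprn_ge0 // ltW. Qed.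

Let term_ge0 a k : 0 <= N a * r ^+ k.
Proof. by rewrite mulr_ge0 ?(sm_ge0 NP). Qed.

Lemma sm_sum (I : Type) (s : seq I) (P : pred I) (F : I -> A) :
  N (\sum_(i <- s | P i) F i) <= \sum_(i <- s | P i) N (F i).
Proof.
elim/big_rec2: _ => [|i y1 y2 _ h]; first by rewrite (sm_0 NP).
by apply: le_trans (sm_D NP _ _) _; rewrite lerD2l.
Qed.

Lemma sm_Mn a k : N (a *+ k) <= N a *+ k.
Proof.
elim: k => [|k IH]; first by rewrite !mulr0n (sm_0 NP).
by rewrite !mulrS; apply: le_trans (sm_D NP _ _) _; rewrite lerD2l.
Qed.

Lemma wsum_fpsC n c : wsum N r n (fpsC c) <= N c.
Proof.
rewrite /wsum; case: n => [|n]; first by rewrite big_ord0 (sm_ge0 NP).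
rewrite big_ord_recl /= expr0 mulr1 big1 ?addr0 // => i _.
by rewrite (sm_0 NP) mul0r.
Qed.

Lemma wsum_fpsX n : wsum N r n (fpsX A) <= r.
Proof.
rewrite /wsum; case: n => [|[|n]]; first by rewrite big_ord0 ltW.
  by rewrite big_ord1 /= (sm_0 NP) mul0r ltW.
rewrite !big_ord_recl /= (sm_0 NP) mul0r add0r expr1 big1 ?addr0.
  by rewrite ler_piMl ?(ltW r_gt0) ?(sm_1 NP).
by move=> i _; rewrite mul0r.
Qed.

Lemma submult_wsum n : submult (wsum N r n).
Proof.
split.
- by move=> a; apply: sumr_ge0.
- by rewrite /wsum big1 // => i _; rewrite fps0E (sm_0 NP) mul0r.
- by apply: le_trans (wsum_fpsC _ _) (sm_1 NP).
- by move=> a; apply: eq_bigr => i _; rewrite (sm_N NP).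
- move=> a b; rewrite /wsum -big_split /=; apply: ler_sum => i _.
  by rewrite -mulrDl ler_wpM2r ?r_ge0 ?(sm_D NP).
move=> a b; rewrite /wsum.
pose F i j : C := (N (a i) * r ^+ i) * (N (b j) * r ^+ j).
have F0 i j : 0 <= F i j by rewrite mulr_ge0.
apply: (@le_trans _ _ (\sum_(k < n) \sum_(i < n | (i <= k)%N) F i (k - i)%N)).
  apply: ler_sum => k _.
  have -> : \sum_(i < n | (i <= k)%N) F i (k - i)%N
          = \sum_(i < k.+1) F i (k - i)%N.
    by rewrite (big_ord_widen n (fun i => F i (k - i)%N)) ?ltn_ord.
  apply: (@le_trans _ _ ((\sum_(i < k.+1) N (a i * b (k - i)%N)) * r ^+ k)).
    by rewrite ler_wpM2r ?r_ge0 // sm_sum.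
  rewrite mulr_suml; apply: ler_sum => i _.
  rewrite /F mulrACA -exprD subnKC; last by rewrite -ltnS.
  by rewrite ler_wpM2r ?r_ge0 ?(sm_M NP).
rewrite (exchange_big_dep xpredT) //= mulr_suml; apply: ler_sum => i _.
rewrite mulr_sumr -/(F _ _).
have := big_mkord (fun k => (i <= k)%N) (fun k => F i (k - i)%N) (n := n) (op := +%R) (idx := 0).
move=> <-.
rewrite -(big_mkord xpredT (fun j => F i j)).
rewrite (big_cat_nat _ (n := i)) ?(ltnW (ltn_ord i)) //=.
rewrite big_nat_cond big1 ?add0r; last first.
  by move=> k /andP[/andP[_ ki] ik]; move: ki; rewrite ltnNge ik.
rewrite big_nat_cond -{1}[i : nat]add0n big_addn.
rewrite [leRHS](big_cat_nat _ (n := (n - i)%N)) ?leq_subr //=.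
have -> : \sum_(0 <= k < n - i | (i <= k + i < n)%N && (i <= k + i)%N) F i (k + i - i)%N
   = \sum_(0 <= k < n - i) F i k.
  rewrite big_nat_cond [RHS]big_nat_cond; apply: eq_big => [k|k _]; last by rewrite addnK.
  rewrite leq_addl /= ltn_subRL [(i + k)%N]addnC !andbT.
  by case: (k + i < n)%N.
by rewrite lerDl sumr_ge0.
Qed.

End Weight.

Section Weight2.
Variable C : numFieldType.

Lemma wsum_le (A : Type) (N N' : A -> C) (r r' : C) (n n' : nat) (a : fps A) :
    (forall u, 0 <= N u) -> (forall u, N u <= N' u) -> 0 < r -> r <= r' ->
    (n <= n')%N ->
  wsum N r n a <= wsum N' r' n' a.
Proof.
move=> N0 NN' r0 rr' nn'; rewrite /wsum.
have r'0 := lt_le_trans r0 rr'.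
apply: (@le_trans _ _ (\sum_(i < n) N' (a i) * r' ^+ i)).
  apply: ler_sum => i _; rewrite ler_pM ?exprn_ge0 ?(ltW r0) //.
  by rewrite lerXn2r ?nnegrE ?(ltW r0) ?(ltW r'0).
rewrite (big_ord_widen n' (fun i => N' (a i) * r' ^+ i)) // big_mkcond.
apply: ler_sum => i _; case: ifP => // _.
by rewrite mulr_ge0 ?exprn_ge0 ?(ltW r'0) // (le_trans (N0 (a i)) (NN' _)).
Qed.

Lemma wsum_deriv (A : comNzRingType) (N : A -> C) (r : C) n (a : fps A) :
    submult N -> 0 < r ->
  wsum N (r / 2) n (fps_deriv a) <= r^-1 * wsum N r n.+1 a.
Proof.
move=> NP r0; rewrite /wsum big_ord_recl mulrDr.
apply: (@le_trans _ _ (r^-1 * \sum_(i < n) N (a i.+1) * r ^+ i.+1)); last first.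
  by rewrite lerDr mulr_ge0 ?invr_ge0 ?(ltW r0) // expr0 mulr1 (sm_ge0 NP).
rewrite mulr_sumr; apply: ler_sum => i _ /=.
have -> : r^-1 * (N (a i.+1) * r ^+ i.+1) = N (a i.+1) * r ^+ i.
  by rewrite mulrCA exprS mulKf ?(gt_eqF r0).
apply: (@le_trans _ _ ((N (a i.+1) *+ i.+1) * (r / 2) ^+ i)).
  by rewrite ler_wpM2r ?(sm_Mn NP) // exprn_ge0 // divr_ge0 ?(ltW r0).
rewrite -[N _ *+ _]mulr_natr -mulrA ler_wpM2l ?(sm_ge0 NP) // exprMn mulrCA.
rewrite ler_piMr ?exprn_ge0 ?(ltW r0) // exprVn.
rewrite ler_pdivrMr ?exprn_gt0 // mul1r -natrX ler_nat.
exact: ltn_expl.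
Qed.

Lemma common_radius (r s : C) : 0 < r -> 0 < s ->
  exists t, [/\ 0 < t, t <= r & t <= s].
Proof.
move=> r0 s0; have rs0 := addr_gt0 r0 s0.
exists (r * s / (r + s)); split; first by rewrite divr_gt0 ?mulr_gt0.
  by rewrite ler_pdivrMr // ler_pM2l // lerDr ltW.
by rewrite ler_pdivrMr // mulrC ler_pM2l // lerDl ltW.
Qed.

End Weight2.

Section ConvergentSeries.
Variable R : realType.
Local Notation C := (R[i]).

(* Absolute convergence on a disc, resp. a polydisc, of radius r > 0
   (0 < r in R[i] makes r real): bounded sums of absolute values. *)
Definition convergent1 : {pred fps C} := fun a =>
  `[< exists r M : C, 0 < r /\
      forall n, \sum_(i < n) `|a i| * r ^+ i <= M >].

Definition convergent2 : {pred fps (fps C)} := fun a =>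
  `[< exists r M : C, 0 < r /\
      forall n, \sum_(i < n) \sum_(j < n) `|a i j| * r ^+ (i + j) <= M >].

Local Notation nrm := (fun z : C => `|z|).
Local Notation nrm1 r n := (wsum nrm r n).
Local Notation nrm2 r n := (wsum (wsum nrm r n) r n).

Lemma convergent1P (a : fps C) :
  reflect (exists r M : C, 0 < r /\ forall n, nrm1 r n a <= M)
    (a \in convergent1).
Proof. exact: asboolP. Qed.

Lemma convergent2P (a : fps (fps C)) :
  reflect (exists r M : C, 0 < r /\ forall n, nrm2 r n a <= M)
    (a \in convergent2).
Proof.
have E r n : nrm2 r n a
    = \sum_(i < n) \sum_(j < n) `|a i j| * r ^+ (i + j).
  apply: eq_bigr => i _; rewrite /wsum mulr_suml; apply: eq_bigr => j _.
  by rewrite exprD -mulrA [r ^+ j * _]mulrC.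
apply: (iffP (asboolP _)) => -[r [M [r0 h]]]; exists r, M; split=> // n.
  by rewrite E.
by rewrite -E.
Qed.

Let nP := submult_norm C.
Let n1P r n (r0 : 0 < r) := submult_wsum nP r0 n.
Let n2P r n (r0 : 0 < r) := submult_wsum (n1P n r0) r0 n.

Let nrm1_le (r s : C) n a : 0 < r -> r <= s -> nrm1 r n a <= nrm1 s n a.
Proof. by move=> r0 rs; apply: wsum_le. Qed.

Let nrm2_le (r s : C) n a : 0 < r -> r <= s -> nrm2 r n a <= nrm2 s n a.
Proof.
by move=> r0 rs; apply: wsum_le => // u; [exact: (sm_ge0 (n1P n r0))|exact: nrm1_le].
Qed.

Fact convergent1_subring : subring_closed convergent1.
Proof.
split.
- apply/convergent1P; exists 1, 1; split=> // n.
  exact: sm_1 (n1P n ltr01).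
- move=> a b /convergent1P[r [M [r0 ha]]] /convergent1P[s [K [s0 hb]]].
  have [t [t0 tr ts]] := common_radius r0 s0.
  apply/convergent1P; exists t, (M + K); split=> // n.
  apply: le_trans (sm_D (n1P n t0) _ _) _; rewrite (sm_N (n1P n t0)).
  by rewrite lerD //; [exact: le_trans (nrm1_le _ _ t0 tr) _|exact: le_trans (nrm1_le _ _ t0 ts) _].
move=> a b /convergent1P[r [M [r0 ha]]] /convergent1P[s [K [s0 hb]]].
have [t [t0 tr ts]] := common_radius r0 s0.
apply/convergent1P; exists t, (M * K); split=> // n.
apply: le_trans (sm_M (n1P n t0) _ _) _.
by rewrite ler_pM ?(sm_ge0 (n1P n t0)) //; [exact: le_trans (nrm1_le _ _ t0 tr) _|exact: le_trans (nrm1_le _ _ t0 ts) _].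
Qed.

Fact convergent2_subring : subring_closed convergent2.
Proof.
split.
- apply/convergent2P; exists 1, 1; split=> // n.
  exact: sm_1 (n2P n ltr01).
- move=> a b /convergent2P[r [M [r0 ha]]] /convergent2P[s [K [s0 hb]]].
  have [t [t0 tr ts]] := common_radius r0 s0.
  apply/convergent2P; exists t, (M + K); split=> // n.
  apply: le_trans (sm_D (n2P n t0) _ _) _; rewrite (sm_N (n2P n t0)).
  by rewrite lerD //; [exact: le_trans (nrm2_le _ _ t0 tr) _|exact: le_trans (nrm2_le _ _ t0 ts) _].
move=> a b /convergent2P[r [M [r0 ha]]] /convergent2P[s [K [s0 hb]]].
have [t [t0 tr ts]] := common_radius r0 s0.
apply/convergent2P; exists t, (M * K); split=> // n.
apply: le_trans (sm_M (n2P n t0) _ _) _.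
by rewrite ler_pM ?(sm_ge0 (n2P n t0)) //; [exact: le_trans (nrm2_le _ _ t0 tr) _|exact: le_trans (nrm2_le _ _ t0 ts) _].
Qed.

HB.instance Definition _ :=
  GRing.isSubringClosed.Build (fps C) convergent1 convergent1_subring.
HB.instance Definition _ :=
  GRing.isSubringClosed.Build (fps (fps C)) convergent2 convergent2_subring.

Fact fpsC_convergent1 (c : C) : fpsC c \in convergent1.
Proof.
apply/convergent1P; exists 1, `|c|; split=> // n.
exact: (wsum_fpsC (N := nrm)).
Qed.

Fact const_convergent2 (c : C) : fpsC (fpsC c) \in convergent2.
Proof.
apply/convergent2P; exists 1, `|c|; split=> // n.
apply: le_trans (wsum_fpsC _ (n1P n ltr01) _ _) _.
exact: (wsum_fpsC (N := nrm)).
Qed.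

Fact x_convergent2 : fpsX (fps C) \in convergent2.
Proof.
apply/convergent2P; exists 1, 1; split=> // n.
exact: (wsum_fpsX (n1P n ltr01) ltr01).
Qed.

Fact y_convergent2 : fpsC (fpsX C) \in convergent2.
Proof.
apply/convergent2P; exists 1, 1; split=> // n.
apply: le_trans (wsum_fpsC _ (n1P n ltr01) _ _) _.
exact: (wsum_fpsX nP ltr01).
Qed.

Let half_gt0 (r : C) : 0 < r -> 0 < r / 2.
Proof. by move=> r0; rewrite divr_gt0. Qed.

Let half_le (r : C) : 0 < r -> r / 2 <= r.
Proof. by move=> r0; rewrite ler_pdivrMr // ler_peMr ?ler1n // ltW. Qed.

Fact dx_convergent2 a : a \in convergent2 -> fps_dx a \in convergent2.
Proof.
move=> /convergent2P[r [M [r0 ha]]]; apply/convergent2P.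
exists (r / 2), (r^-1 * M); split=> [|n]; first exact: half_gt0.
apply: (@le_trans _ _ (wsum (nrm1 r n) (r / 2) n (fps_dx a))).
  apply: wsum_le => // [u|u|]; first exact: (sm_ge0 (n1P n (half_gt0 r0))).
    by apply: nrm1_le; rewrite ?half_gt0 ?half_le.
  exact: half_gt0.
apply: le_trans (wsum_deriv _ _ (n1P n r0) r0) _.
rewrite ler_wpM2l ?invr_ge0 ?(ltW r0) //; apply: le_trans (ha n.+1).
apply: wsum_le => // u; first exact: (sm_ge0 (n1P n r0)).
exact: wsum_le.
Qed.

Fact dy_convergent2 a : a \in convergent2 -> fps_dy a \in convergent2.
Proof.
move=> /convergent2P[r [M [r0 ha]]]; apply/convergent2P.
exists (r / 2), (r^-1 * M); split=> [|n]; first exact: half_gt0.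
apply: (@le_trans _ _ (r^-1 * nrm2 r n.+1 a)); last first.
  by rewrite ler_wpM2l ?invr_ge0 ?(ltW r0).
apply: (@le_trans _ _ (r^-1 * wsum (nrm1 r n.+1) r n a)); last first.
  rewrite ler_wpM2l ?invr_ge0 ?(ltW r0) //; apply: wsum_le => // u.
  exact: (sm_ge0 (n1P n.+1 r0)).
rewrite [leRHS]mulr_sumr; apply: ler_sum => i _ /=.
rewrite mulrA; apply: ler_pM.
- exact: (sm_ge0 (n1P n (half_gt0 r0))).
- by rewrite exprn_ge0 ?ltW ?half_gt0.
- exact: (wsum_deriv _ _ nP r0).
by rewrite lerXn2r ?nnegrE ?(ltW r0) ?(ltW (half_gt0 r0)) ?half_le.
Qed.

End ConvergentSeries.

(* cps1 R is C{t} and cps2 R is C{x,y}, with C = R[i].  Both are made unit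
   rings by choosing inverses classically among convergent series. *)

Record cps1 (R : realType) := Cps1 {
  series1 :> fps R[i]; _ : series1 \in @convergent1 R }.
Record cps2 (R : realType) := Cps2 {
  series2 :> fps (fps R[i]); _ : series2 \in @convergent2 R }.

Section ConvergentRings.
Variable R : realType.
Local Notation C := (R[i]).

HB.instance Definition _ := [isSub for @series1 R].
HB.instance Definition _ := [Choice of cps1 R by <:].
HB.instance Definition _ := [SubChoice_isSubComNzRing of cps1 R by <:].

HB.instance Definition _ := [isSub for @series2 R].
HB.instance Definition _ := [Choice of cps2 R by <:].
HB.instance Definition _ := [SubChoice_isSubComNzRing of cps2 R by <:].

Let fieldI (u v : C) : u * v = 0 -> u = 0 \/ v = 0.
Proof. by move=> /eqP; rewrite mulf_eq0 => /orP[]/eqP; [left|right]. Qed.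

Section ClassicalUnits.
Variable A : comNzRingType.

Definition is_inv : {pred A} := fun a => `[< exists b, b * a = 1 >].
Definition inv_or_self (a : A) : A :=
  if pselect (exists b, b * a = 1) is left e then projT1 (cid e) else a.

Fact inv_or_selfV : {in is_inv, left_inverse 1 inv_or_self *%R}.
Proof.
by move=> a /asboolP e; rewrite /inv_or_self; case: pselect => // e'; case: cid.
Qed.

Fact is_inv_intro (a b : A) : b * a = 1 -> is_inv a.
Proof. by move=> ba; apply/asboolP; exists b. Qed.

Fact inv_or_self_out : {in [predC is_inv], inv_or_self =1 id}.
Proof.
by move=> a /asboolP ne; rewrite /inv_or_self; case: pselect.
Qed.
End ClassicalUnits.

HB.instance Definition _ := GRing.ComNzRing_hasMulInverse.Build (cps1 R)
  (@inv_or_selfV _) (@is_inv_intro _) (@inv_or_self_out _).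
HB.instance Definition _ := GRing.ComNzRing_hasMulInverse.Build (cps2 R)
  (@inv_or_selfV _) (@is_inv_intro _) (@inv_or_self_out _).

Fact cps1_integral (a b : cps1 R) : a * b = 0 -> (a == 0) || (b == 0).
Proof.
move=> /(congr1 val); rewrite rmorphM rmorph0 => /(fps_integral fieldI)[] ab0.
  by apply/orP; left; apply/eqP/val_inj; rewrite ab0 rmorph0.
by apply/orP; right; apply/eqP/val_inj; rewrite ab0 rmorph0.
Qed.

Fact cps2_integral (a b : cps2 R) : a * b = 0 -> (a == 0) || (b == 0).
Proof.
move=> /(congr1 val); rewrite rmorphM rmorph0.
move=> /(fps_integral (fps_integral fieldI))[] ab0.
  by apply/orP; left; apply/eqP/val_inj; rewrite ab0 rmorph0.
by apply/orP; right; apply/eqP/val_inj; rewrite ab0 rmorph0.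
Qed.

HB.instance Definition _ :=
  GRing.ComUnitRing_isIntegral.Build (cps1 R) cps1_integral.
HB.instance Definition _ :=
  GRing.ComUnitRing_isIntegral.Build (cps2 R) cps2_integral.

Definition const1 (c : C) : cps1 R := Cps1 (fpsC_convergent1 c).
Definition const2 (c : C) : cps2 R := Cps2 (const_convergent2 c).
Definition coord_x : cps2 R := Cps2 (x_convergent2 R).
Definition coord_y : cps2 R := Cps2 (y_convergent2 R).
Definition pdx (a : cps2 R) : cps2 R := Cps2 (dx_convergent2 (valP a)).
Definition pdy (a : cps2 R) : cps2 R := Cps2 (dy_convergent2 (valP a)).

End ConvergentRings.

Notation "x %:F" := (@FracField.tofrac _ x).

Section Curve.
Variable R : realType.
Local Notation S := (cps2 R).
Local Notation T := (cps1 R).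
Local Notation QS := {fraction S}.
Local Notation QT := {fraction T}.

Definition divides (a b : S) : Prop := exists c, b = c * a.

Definition irreducible (a : S) : Prop :=
  [/\ a != 0, a \isn't a GRing.unit &
      forall b c, a = b * c -> b \is a GRing.unit \/ c \is a GRing.unit].

(* f is a reduced equation of a plane curve germ D through the origin whose
   irreducible components are the D_i = {fs i = 0}. *)
Definition reduced_curve (p : nat) (f : S) (fs : 'I_p -> S) : Prop :=
  [/\ f \isn't a GRing.unit,
      forall h n, divides f (h ^+ n) -> divides f h,
      forall i, irreducible (fs i)
    & exists2 u, u \is a GRing.unit & f = u * \prod_(i < p) fs i].

(* a induces a non zero divisor in O_D = C{x,y}/(f) *)
Definition nzd_mod (f a : S) : Prop :=
  forall b, divides f (a * b) -> divides f b.

(* The product of the fraction fields Q(C{t_i}), which contains the product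
   of the C{t_i}. *)
Definition total_frac (p : nat) := {ffun 'I_p -> QT}.

Section Normalization.
Variables (p : nat) (phi : 'I_p -> {rmorphism S -> T}).

Definition pullback (h : S) : total_frac p := [ffun i => (phi i h)%:F].

Definition integral_over (q : total_frac p) : Prop :=
  exists (n : nat) (c : 'I_n -> S),
    q ^+ n + \sum_(k < n) pullback (c k) * q ^+ k = 0.

(* The phi i identify the normalization of O_D = C{x,y}/(f) with the product
   of the C{t_i}, the i-th factor corresponding to the component D_i:
   the phi i are C-algebra morphisms, together they embed O_D in the product
   of the Q(C{t_i}), which is its total ring of fractions (non zero divisors
   become units, and every element is a fraction with such a denominator),
   and in which the product of the C{t_i} is its integral closure. *)
Record normalization (f : S) (fs : 'I_p -> S) : Prop := Normalization {
  norm_const : forall i c, phi i (const2 c) = const1 c;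
  norm_comp : forall i h, phi i h = 0 <-> divides (fs i) h;
  norm_ker : forall h, pullback h = 0 <-> divides f h;
  norm_unit : forall b, nzd_mod f b ->
    exists q : total_frac p, q * pullback b = 1;
  norm_frac : forall q : total_frac p, exists a b : S,
    nzd_mod f b /\ q * pullback b = pullback a;
  norm_closure : forall q : total_frac p,
    integral_over q <-> exists u : 'I_p -> T, q = [ffun i => (u i)%:F] }.

End Normalization.

(* order of vanishing at t = 0, with value 0 at the zero series *)
Definition ord (a : T) : nat :=
  if pselect (exists n, a n != 0) is left e then ex_minn e else 0%N.

Definition val_t (q : QT) : \bar int :=
  if q == 0 then +oo%E
  else ((ord \n_(repr q))%:Z - (ord \d_(repr q))%:Z)%:E.

(* val(I), for I a subset of Q(O_D) *)
Definition value_set (p : nat) (I : total_frac p -> Prop)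
    (v : {ffun 'I_p -> int}) : Prop :=
  exists q, [/\ I q, forall s, q * s = 0 -> s = 0
              & forall i, val_t (q i) = (v i)%:E].

(* Meromorphic 1-forms w.1 dx + w.2 dy.  Partial derivatives are extended to
   fractions by the quotient rule. *)
Definition frac_der (d : S -> S) (q : QS) : QS :=
  let n := \n_(repr q) in let m := \d_(repr q) in
  (d n * m - n * d m)%:F / (m ^+ 2)%:F.

Definition mero_form : Type := (QS * QS)%type.

Definition holomorphic (q : QS) : Prop := exists h : S, q = h%:F.

Definition log_form (f : S) (w : mero_form) : Prop :=
  [/\ holomorphic (f%:F * w.1), holomorphic (f%:F * w.2)
    & holomorphic (f%:F *
        (frac_der (@pdx R) w.2 - frac_der (@pdy R) w.1))].

(* r = res(w): g w = xi df/f + eta1 dx + eta2 dy and r = xi/g restricted to D *)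
Definition is_residue (p : nat) (phi : 'I_p -> {rmorphism S -> T}) (f : S)
    (w : mero_form) (r : total_frac p) : Prop :=
  exists g xi eta1 eta2 : S,
    [/\ nzd_mod f g,
        g%:F * w.1 = xi%:F * ((pdx f)%:F / f%:F) + eta1%:F,
        g%:F * w.2 = xi%:F * ((pdy f)%:F / f%:F) + eta2%:F
      & r = [ffun i => (phi i xi)%:F / (phi i g)%:F]].

Definition log_residues (p : nat) (phi : 'I_p -> {rmorphism S -> T}) (f : S)
    (r : total_frac p) : Prop :=
  exists2 w, log_form f w & is_residue phi f w r.

(* The minimum is never +oo: x and y do not both vanish on a branch. *)
Definition multiplicity (p : nat) (phi : 'I_p -> {rmorphism S -> T})
    (j : 'I_p) : int :=
  fine (Order.min (val_t (phi j (coord_x R))%:F)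
                  (val_t (phi j (coord_y R))%:F)).

End Curve.

(* nu is the least element, for the product order, of the set of the mu such
   that mu + N^p is contained in V. *)
Definition is_conductor (p : nat) (V : {ffun 'I_p -> int} -> Prop)
    (nu : {ffun 'I_p -> int}) : Prop :=
  let above (mu : {ffun 'I_p -> int}) :=
    forall n : 'I_p -> nat, V [ffun i => mu i + (n i)%:Z] in
  above nu /\ forall mu, above mu -> forall i, nu i <= mu i.

(* Main.v *)
From HB Require Import structures.
Require Import Defs.
From mathcomp Require Import all_boot all_order all_algebra.
From mathcomp Require Import complex boolp reals constructive_ereal.
From mathcomp Require Import generic_quotient ring zify.

Set Implicit Arguments.
Unset Strict Implicit.
Unset Printing Implicit Defensive.

Import Order.TTheory GRing.Theory Num.Theory.
Local Open Scope ring_scope.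

(** Let O_D be the image of C{x,y} in the product O~ of the rings C{t_j}, and
    let x_j', y_j' be the components of the velocity of the branch D_j.

    A form (a dx + b dy)/f is logarithmic exactly when b f_x - a f_y lies in
    (f), and its residue is then a/f_x = b/f_y.  Hence R_D consists of the q
    in Q(O_D) such that q f_x and q f_y belong to O_D (log_residuesP).  As f
    vanishes on D_j, there is a nonzero s_j in Q(C{t_j}) with f_y = s_j x_j'
    and f_x = - s_j y_j' on D_j (slope_exists), while the smaller of the
    orders of x_j' and y_j' is m^(j) - 1 (multiplicityP).  The proposition
    then follows from two facts about the pairing of q and q' by the residues
    of q q' dt / s_j, that is, from the duality that makes O_D a Gorenstein
    ring:
    - s O~ is contained in O_D (slope_in_OD).  If the j-th value of q is at
      least 1 - m^(j) for every j, then q x_j' and q y_j' are regular, so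
      q f_x and q f_y are in s O~ and q is a residue.
    - s c is never in O_D if c has a simple pole on one branch and is regular
      on the others (no_isolated_pole).  If q is a residue of value - m^(i) on
      D_i and of nonnegative value elsewhere, then q f_x or q f_y has this
      form.

    The pairing is constructed as an iterated residue.  Choose a line
    x = l y on which f does not vanish and put z = x - l y.  Expanding in
    powers of z, with coefficients that are Laurent series in y, makes f
    invertible, and the residue in y of h/f is a power series in z attached to
    h (line_res).  It kills (f) and is linear over the series in z, hence it
    extends to a functional on Q(O_D): if q z^(k+1) = h on D, take the
    coefficient of z^k in line_res h (curve_residue).  On the line f is a
    power of y times a unit, which gives nondegeneracy modulo z
    (line_res_nondegenerate) and, by lowering the exponent k, shows that O_D
    is its own orthogonal (curve_residue_orthogonal).

    To compare this functional with the residues on the branches, note that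
    the bracket b_x f_y - b_y f_x divided by f is a divergence, so its residue
    in y is a derivative in z (line_res_bracket), and that the bracket
    restricts to s_j times the derivative of b on D_j.  Thus the functional
    kills s g' for every g in Q(O_D) (curve_residue_slope_der).  A Laurent
    series is a derivative up to a multiple of 1/t (frac_residue_split), so on
    each branch the functional is a constant multiple of the residue of
    q dt / s_j, and the constant is not zero because O_D is its own orthogonal
    (branch_residue_simple_pole).

    One finiteness statement is used: t^N O~ is contained in O_D for some N
    (conductor_exists).  It comes from the fact that C{t_j} is generated by
    finitely many powers of t_j over the series in a coordinate that is not
    constant on D_j (division_by_series); it turns congruences modulo high
    powers of t into exact equalities in O_D. *)

(** * Derivations and formal power series *)

Definition derivation (A : pzRingType) (d : A -> A) : Prop :=
  (forall a b, d (a + b) = d a + d b) /\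
  (forall a b, d (a * b) = d a * b + a * d b).

Section Derivation.
Variables (A : comNzRingType) (d : A -> A).
Hypothesis dP : derivation d.

Lemma der0 : d 0 = 0.
Proof. by apply: (@addrI _ (d 0)); rewrite -dP.1 !addr0. Qed.
Lemma derN a : d (- a) = - d a.
Proof. by apply: (@addrI _ (d a)); rewrite -dP.1 !subrr der0. Qed.
Lemma derB a b : d (a - b) = d a - d b.
Proof. by rewrite dP.1 derN. Qed.
Lemma der1 : d 1 = 0.
Proof.
by apply: (@addrI _ (d 1)); rewrite addr0 -{3}[1]mulr1 dP.2 mulr1 mul1r.
Qed.
Lemma derX a n : d (a ^+ n.+1) = (d a * a ^+ n) *+ n.+1.
Proof.
elim: n => [|n IH]; first by rewrite expr1 expr0 mulr1.
by rewrite exprS dP.2 IH mulrnAr mulrCA -exprS [RHS]mulrS.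
Qed.
End Derivation.

Section FormalSeries.
Variable A : comNzRingType.
Implicit Types (a b : fps A) (n : nat).

Lemma fpsDE a b n : (a + b) n = a n + b n. Proof. by []. Qed.
Lemma fpsNE a n : (- a) n = - a n. Proof. by []. Qed.
Lemma fpsBE a b n : (a - b) n = a n - b n. Proof. by []. Qed.
Lemma fpsME a b n : (a * b) n = \sum_(i < n.+1) a i * b (n - i)%N.
Proof. by []. Qed.
Lemma fps1E n : (1 : fps A) n = (n == 0%N)%:R. Proof. by case: n. Qed.

Lemma fpsMnE a k n : (a *+ k) n = a n *+ k.
Proof. by elim: k => [|k IH]; rewrite ?mulr0n ?fps0E // !mulrS fpsDE IH. Qed.

Lemma fps_sumE (I : Type) (s : seq I) (P : pred I) (F : I -> fps A) n :
  (\sum_(i <- s | P i) F i) n = \sum_(i <- s | P i) F i n.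
Proof. by elim/big_rec2: _ => [|i x y _ <-]; rewrite ?fps0E. Qed.

Lemma fpsM0E a b : (a * b) 0%N = a 0%N * b 0%N.
Proof. by rewrite fpsME big_ord1. Qed.

Lemma fpsCME c a n : (fpsC c * a) n = c * a n.
Proof.
rewrite fpsME big_ord_recl subn0 big1 ?addr0 // => i _.
by rewrite mul0r.
Qed.

Lemma fpsXM0 a : (fpsX A * a) 0%N = 0.
Proof. by rewrite fpsM0E mul0r. Qed.
Lemma fpsXMS a n : (fpsX A * a) n.+1 = a n.
Proof.
rewrite fpsME 2!big_ord_recl mul0r add0r mul1r subSS subn0 big1 ?addr0 //.
by move=> i _; rewrite mul0r.
Qed.

Lemma fpsXnM k a n :
  (fpsX A ^+ k * a) n = if (n < k)%N then 0 else a (n - k)%N.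
Proof.
elim: k n => [|k IH] n; first by rewrite expr0 mul1r subn0.
rewrite exprS -mulrA; case: n => [|n]; first by rewrite fpsXM0.
by rewrite fpsXMS IH ltnS subSS.
Qed.

Lemma fpsM_low a b m n : (forall i, (i < m)%N -> a i = 0) ->
  (forall i, (i < n)%N -> b i = 0) -> forall k, (k < m + n)%N -> (a * b) k = 0.
Proof.
move=> ha hb k kmn; rewrite fpsME big1 // => i _.
case: (ltnP i m) => [/ha ->|mi]; first by rewrite mul0r.
rewrite hb ?mulr0 //; have := ltn_ord i; rewrite ltnS => ik.
by rewrite ltn_subLR // (leq_trans kmn) // leq_add2r.
Qed.

Lemma fpsX_low a m : a 0%N = 0 -> forall i, (i < m)%N -> (a ^+ m) i = 0.
Proof.
move=> a0; elim: m => [//|m IH] i im; rewrite exprS.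
by apply: (@fpsM_low _ _ 1 m) => // -[].
Qed.

Lemma fps_deriv_der : derivation (@fps_deriv A).
Proof.
split=> a b; apply: fpsP => n; first by rewrite /= mulrnDl.
transitivity ((a * b) n.+1 *+ n.+1); first by [].
rewrite fpsDE !fpsME -sumrMnl.
have E (i : 'I_n.+2) : (a i * b (n.+1 - i)%N) *+ n.+1 =
     (a i *+ i) * b (n.+1 - i)%N + a i * (b (n.+1 - i)%N *+ (n.+1 - i)).
  by rewrite mulrnAl mulrnAr -mulrnDr subnKC // -ltnS.
rewrite (eq_bigr _ (fun i _ => E i)).
rewrite big_split /=; congr (_ + _).
  by rewrite big_ord_recl mulr0n mul0r add0r; apply: eq_bigr => i _.
rewrite big_ord_recr /= subnn mulr0n mulr0 addr0; apply: eq_bigr => i _.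
by rewrite subSn // -ltnS.
Qed.

Lemma fps_geometric (r : fps A) : r 0%N = 0 -> exists b, (1 - r) * b = 1.
Proof.
move=> r0; exists (Fps (fun n => (\sum_(l < n.+1) r ^+ l) n)).
apply: fpsP => n.
(* r^l has no terms of degree less than l, so truncating the geometric series
   after r^n does not change the coefficients up to degree n. *)
transitivity (((1 - r) * \sum_(l < n.+1) r ^+ l) n).
  rewrite 2!fpsME; apply: eq_bigr => i _; congr (_ * _) => /=.
  rewrite !fps_sumE.
  have le : (n - i <= n)%N by rewrite leq_subr.
  rewrite -(big_mkord xpredT (fun l => (r ^+ l) (n - i)%N)).
  rewrite -[RHS](big_mkord xpredT (fun l => (r ^+ l) (n - i)%N)).
  rewrite [RHS](big_cat_nat _ (n := (n - i).+1)) //=.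
  rewrite [X in _ = _ + X]big_nat_cond [X in _ = _ + X]big1 ?addr0 //.
  by move=> l /andP[/andP[li _] _]; rewrite fpsX_low.
have -> : \sum_(l < n.+1) r ^+ l = \sum_(l < n.+1) 1 ^+ (n.+1.-1 - l) * r ^+ l.
  by apply: eq_bigr => l _; rewrite expr1n mul1r.
by rewrite -subrXX expr1n fpsBE fpsX_low // subr0.
Qed.

Lemma fps_inverse a (u : A) : u * a 0%N = 1 -> exists b, b * a = 1.
Proof.
move=> ua; pose r := 1 - fpsC u * a.
have r0 : r 0%N = 0 by rewrite fpsBE fpsCME ua subrr.
have [b] := fps_geometric r0; rewrite /r opprB addrC subrK => e.
by exists (b * fpsC u); rewrite -e; ring.
Qed.

End FormalSeries.

(** A Taylor expansion is multiplicative: both sides of the identity satisfy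
    the same first-order differential equation with the same initial value. *)
Lemma taylor_multiplicative (A B : comNzRingType) (D : A -> A)
    (tau : A -> fps B) :
    derivation D -> (forall (b : B) n, b *+ n.+1 = 0 -> b = 0) ->
    (forall a b, tau (a + b) = tau a + tau b) ->
    (forall a b, tau (a * b) 0%N = tau a 0%N * tau b 0%N) ->
    (forall a, fps_deriv (tau a) = tau (D a)) ->
  forall a b, tau (a * b) = tau a * tau b.
Proof.
move=> DP tf tD t0 tS a b; apply: fpsP => n; elim: n a b => [|n IH] a b.
  by rewrite t0 fpsM0E.
have inj (u v : B) : (u - v) *+ n.+1 = 0 -> u = v.
  by move=> /tf /eqP; rewrite subr_eq0 => /eqP.
apply: inj.
rewrite mulrnBl; apply/eqP; rewrite subr_eq0; apply/eqP.
have dE (c : fps B) : c n.+1 *+ n.+1 = fps_deriv c n by [].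
rewrite !dE (fps_deriv_der B).2 !tS fpsDE -!IH.
by rewrite DP.2 tD.
Qed.

(** * Estimates and convergence *)

Definition fshift (A : Type) (a : fps A) : fps A := Fps (fun n => a n.+1).

Section Estimates.
Variable C : numFieldType.

Lemma wsum_shift (A : Type) (N : A -> C) (r : C) n (a : fps A) :
    (forall u, 0 <= N u) -> 0 < r ->
  wsum N r n (fshift a) <= r^-1 * wsum N r n.+1 a.
Proof.
move=> N0 r0; rewrite /wsum big_ord_recl mulrDr mulr_sumr expr0 mulr1.
rewrite -[leLHS]add0r lerD ?mulr_ge0 ?invr_ge0 ?(ltW r0) //.
apply: ler_sum => i _ /=.
by rewrite mulrCA exprS mulKf ?(gt_eqF r0).
Qed.

Lemma wsum_coef (A : Type) (N : A -> C) (r : C) n (a : fps A) (i : 'I_n) :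
    (forall u, 0 <= N u) -> 0 < r -> N (a i) * r ^+ i <= wsum N r n a.
Proof.
move=> N0 r0; rewrite /wsum (bigD1 i) //= lerDl sumr_ge0 // => j _.
by rewrite mulr_ge0 // exprn_ge0 // ltW.
Qed.

(** This makes a series without constant term small.  The norm N' of the
    coefficients may be smaller than N, so that the lemma can be used first in
    one variable and then in the other. *)
Lemma wsum_shrink (A : Type) (N N' : A -> C) (r s : C) n (a : fps A) :
    (forall u, 0 <= N u) -> (forall u, N' u <= N u) ->
    N' (a 0%N) <= r / s * N (a 0%N) -> 0 < r -> r <= s ->
  wsum N' r n a <= r / s * wsum N s n a.
Proof.
move=> N0 NN' Na r0 rs; have s0 := lt_le_trans r0 rs.
rewrite /wsum mulr_sumr; apply: ler_sum => i _.
case: i => -[|i] lt /=; first by rewrite !expr0 !mulr1.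
rewrite mulrCA; apply: (@le_trans _ _ (N (a i.+1) * r ^+ i.+1)).
  by rewrite ler_wpM2r ?NN' // exprn_ge0 // ltW.
rewrite ler_wpM2l // !exprS -mulrA ler_wpM2l ?(ltW r0) //.
by rewrite mulKf ?(gt_eqF s0) // lerXn2r ?nnegrE ?(ltW r0) ?(ltW s0).
Qed.

Lemma shrink_radius (s M : C) : 0 < s -> 0 <= M ->
  exists r : C, [/\ 0 < r, r <= s & r / s * M <= 2^-1].
Proof.
move=> s0 M0; pose d : C := 2 * M + 1.
have d1 : 1 <= d by rewrite lerDr mulr_ge0.
have d0 : 0 < d := lt_le_trans ltr01 d1.
exists (s / d); split; first by rewrite divr_gt0.
  by rewrite ler_pdivrMr // ler_peMr // ltW.
have -> : s / d / s = d^-1 by rewrite mulrAC divff ?mul1r ?gt_eqF.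
rewrite -ler_pdivlMl ?invr_gt0 // invrK ler_pdivlMr //.
by rewrite mulrC lerDl.
Qed.

(** For N a truncated norm and b a formal inverse of 1 - r, this bounds the
    partial sums of the norm of b independently of the truncation. *)
Lemma submult_inverse (A : comNzRingType) (N : A -> C) (r b : A) :
  submult N -> N r <= 2^-1 -> b = 1 + r * b -> N b <= 2.
Proof.
move=> NP r2 e; have b0 := sm_ge0 NP b.
have le : N b <= 1 + 2^-1 * N b.
  rewrite {1}e; apply: le_trans (sm_D NP _ _) _.
  apply: lerD; first exact: sm_1 NP.
  by apply: le_trans (sm_M NP _ _) _; rewrite ler_wpM2r.
have : N b - 2^-1 * N b <= 1 by rewrite lerBlDr.
have -> : N b - 2^-1 * N b = N b / 2 by field.
by rewrite ler_pdivrMr // mul1r.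
Qed.

Lemma sum_antidiagonal (F : nat -> nat -> C) n :
  \sum_(k < n) \sum_(i < k.+1) F i (k - i)%N =
  \sum_(i < n) \sum_(j < n - i) F i j.
Proof.
elim: n => [|n IH]; first by rewrite !big_ord0.
rewrite big_ord_recr IH /= big_ord_recr /= [RHS]big_ord_recr /=.
rewrite subnn subSnn big_ord1 addrA -big_split; congr (_ + _).
by apply: eq_bigr => i _ /=; rewrite subSn ?(ltnW (ltn_ord i)) // big_ord_recr.
Qed.

End Estimates.

Section Convergence.
Variable R : realType.
Local Notation C := (R[i]).
Local Notation nrm := (fun z : C => `|z|).
Local Notation nrm1 r n := (wsum nrm r n).
Local Notation nrm2 r n := (wsum (wsum nrm r n) r n).

Let nP := submult_norm C.
Let n1P r n (r0 : 0 < r) := submult_wsum nP r0 n.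
Let n2P r n (r0 : 0 < r) := submult_wsum (n1P n r0) r0 n.

Lemma convergent1_dominated (a b : fps C) (K : C) :
    (forall i, `|b i| <= K * `|a i|) -> a \in @convergent1 R ->
  b \in @convergent1 R.
Proof.
move=> h /convergent1P[r [M [r0 ha]]].
have [K0|K0] := boolP (0 <= K).
  apply/convergent1P; exists r, (K * M); split=> // n.
  apply: (@le_trans _ _ (K * nrm1 r n a)); last by rewrite ler_wpM2l.
  rewrite /wsum mulr_sumr; apply: ler_sum => i _.
  by rewrite mulrA ler_wpM2r // exprn_ge0 // ltW.
have b0 : forall i, b i = 0.
  move=> i; apply/eqP; rewrite -normr_le0; have := h i.
  have [->|ai] := eqVneq (a i) 0; first by rewrite normr0 mulr0.
  move=> hb; have : 0 <= K * `|a i| by apply: le_trans hb.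
  by rewrite pmulr_lge0 ?normr_gt0 // (negPf K0).
apply/convergent1P; exists 1, 0; split=> // n.
by rewrite /wsum big1 // => i _; rewrite b0 normr0 mul0r.
Qed.

(** At the radius 1/(2q) the terms are dominated by K/2^i. *)
Lemma convergent1_geometric (a : fps C) (K q : C) :
  0 < q -> (forall i, `|a i| <= K * q ^+ i) -> a \in @convergent1 R.
Proof.
move=> q0 h; have K0 : 0 <= K.
  by have := h 0%N; rewrite expr0 mulr1; apply: le_trans.
apply/convergent1P; exists (2 * q)^-1, (K * 2).
split=> [|n]; first by rewrite invr_gt0 mulr_gt0.
apply: (@le_trans _ _ (K * \sum_(i < n) 2^-1 ^+ i)).
  rewrite /wsum mulr_sumr; apply: ler_sum => i _.
  apply: (@le_trans _ _ (K * q ^+ i * (2 * q)^-1 ^+ i)).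
    by rewrite ler_wpM2r // exprn_ge0 // invr_ge0 mulr_ge0 // ltW.
  by rewrite -mulrA -exprMn invfM mulrCA divff ?mulr1 // gt_eqF.
rewrite ler_wpM2l //.
have e : \sum_(i < n) 2^-1 ^+ i = 2 * (1 - 2^-1 ^+ n) :> C.
  elim: n => [|n IH]; first by rewrite big_ord0 expr0 subrr mulr0.
  by rewrite big_ord_recr /= IH exprS; field.
by rewrite e ler_piMr // lerBlDr lerDl exprn_ge0 // invr_ge0.
Qed.

Lemma fshift_convergent1 (a : fps C) :
  a \in @convergent1 R -> fshift a \in @convergent1 R.
Proof.
move=> /convergent1P[r [M [r0 ha]]]; apply/convergent1P.
exists r, (r^-1 * M); split=> // n; apply: le_trans (wsum_shift _ _ _ r0) _ => //.
by rewrite ler_wpM2l // invr_ge0 ltW.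
Qed.

Lemma fshift_convergent2 (a : fps (fps C)) :
  a \in @convergent2 R -> fshift a \in @convergent2 R.
Proof.
move=> /convergent2P[r [M [r0 ha]]]; apply/convergent2P.
exists r, (r^-1 * M); split=> // n.
apply: le_trans (wsum_shift _ _ (sm_ge0 (n1P n r0)) r0) _.
rewrite ler_wpM2l ?invr_ge0 ?(ltW r0) //; apply: le_trans (ha n.+1).
by apply: wsum_le => // u; [exact: (sm_ge0 (n1P n r0))|exact: wsum_le].
Qed.

Lemma slice_convergent1 (a : fps (fps C)) :
  a \in @convergent2 R -> a 0%N \in @convergent1 R.
Proof.
move=> /convergent2P[r [M [r0 ha]]]; apply/convergent1P.
exists r, M; split=> // n; apply: le_trans (ha n.+1).
apply: (@le_trans _ _ (nrm1 r n.+1 (a 0%N) * r ^+ 0)).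
  by rewrite expr0 mulr1; apply: wsum_le.
exact: (wsum_coef a (ord0 : 'I_n.+1) (sm_ge0 (n1P n.+1 r0)) r0).
Qed.

Lemma fpsC_convergent2 (a : fps C) :
  a \in @convergent1 R -> fpsC a \in @convergent2 R.
Proof.
move=> /convergent1P[r [M [r0 ha]]]; apply/convergent2P.
exists r, M; split=> // n; apply: le_trans (ha n).
exact: wsum_fpsC (n1P n r0) _ _.
Qed.

Lemma fpsmap_convergent2 (a : fps C) :
  a \in @convergent1 R -> Fps (fun i => fpsC (a i)) \in @convergent2 R.
Proof.
move=> /convergent1P[r [M [r0 ha]]]; apply/convergent2P.
exists r, M; split=> // n; apply: le_trans (ha n).
apply: ler_sum => i _; rewrite ler_wpM2r ?exprn_ge0 ?(ltW r0) //=.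
exact: (wsum_fpsC (N := nrm)).
Qed.

Lemma deriv_convergent1 (a : fps C) :
  a \in @convergent1 R -> fps_deriv a \in @convergent1 R.
Proof.
move=> /convergent1P[r [M [r0 ha]]]; apply/convergent1P.
exists (r / 2), (r^-1 * M); split=> [|n]; first by rewrite divr_gt0.
apply: le_trans (wsum_deriv _ _ nP r0) _.
by rewrite ler_wpM2l ?invr_ge0 ?(ltW r0).
Qed.

(** After division by the constant term a is 1 - r with r small on a small
    disc. *)
Lemma inverse_convergent1 (a b : fps C) :
  a \in @convergent1 R -> b * a = 1 -> b \in @convergent1 R.
Proof.
move=> ac ba; have a0 : a 0%N != 0.
  have e : (b * a) 0%N = 1 by rewrite ba.
  by apply/eqP => a0; move/eqP: e; rewrite fpsM0E a0 mulr0 eq_sym oner_eq0.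
pose c := (a 0%N)^-1; pose r := 1 - fpsC c * a; pose b' := fpsC (a 0%N) * b.
have rc : r \in @convergent1 R.
  by rewrite rpredB ?rpred1 // rpredM // fpsC_convergent1.
have cc : fpsC c * fpsC (a 0%N) = 1.
  by apply: fpsP => n; rewrite fpsCME fps1E; case: n => [|n] /=; rewrite ?mulr0 ?mulVf.
have eb : b' = 1 + r * b'.
  suff -> : r * b' = b' - 1 by ring.
  rewrite /r mulrBl mul1r; congr (_ - _).
  by rewrite /b' mulrACA cc mul1r mulrC.
have /convergent1P[s [M [s0 hr]]] := rc.
have M0 : 0 <= M by have := hr 0%N; rewrite /wsum big_ord0.
have [q [q0 qs qM]] := shrink_radius s0 M0.
have -> : b = fpsC c * b' by rewrite /b' mulrA cc mul1r.
rewrite rpredM ?fpsC_convergent1 //; apply/convergent1P; exists q, 2.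
split=> // n; apply: (submult_inverse (n1P n q0) _ eb).
apply: le_trans qM; apply: (@le_trans _ _ (q / s * nrm1 s n r)).
  apply: wsum_shrink => //; rewrite /r fpsBE fpsCME fps1E mulVf // subrr.
  by rewrite normr0 mulr0.
by rewrite ler_wpM2l // divr_ge0 ?ltW.
Qed.

Lemma inverse_convergent2 (a b : fps (fps C)) :
  a \in @convergent2 R -> b * a = 1 -> b \in @convergent2 R.
Proof.
move=> ac ba; have a0 : a 0%N 0%N != 0.
  have e : (b * a) 0%N 0%N = 1 by rewrite ba.
  by apply/eqP => a0; move/eqP: e; rewrite !fpsM0E a0 mulr0 eq_sym oner_eq0.
pose cst (u : C) := fpsC (fpsC u).
pose c := (a 0%N 0%N)^-1; pose r := 1 - cst c * a; pose b' := cst (a 0%N 0%N) * b.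
have rc : r \in @convergent2 R.
  by rewrite rpredB ?rpred1 // rpredM // const_convergent2.
have cc : cst c * cst (a 0%N 0%N) = 1.
  apply: fpsP => n; rewrite fpsCME fps1E; case: n => [|n] /=; rewrite ?mulr0 //.
  by apply: fpsP => n; rewrite fpsCME fps1E; case: n => [|n] /=; rewrite ?mulr0 ?mulVf.
have eb : b' = 1 + r * b'.
  suff -> : r * b' = b' - 1 by ring.
  rewrite /r mulrBl mul1r; congr (_ - _).
  by rewrite /b' mulrACA cc mul1r mulrC.
have /convergent2P[s [M [s0 hr]]] := rc.
have M0 : 0 <= M by have := hr 0%N; rewrite /wsum big_ord0.
have [q [q0 qs qM]] := shrink_radius s0 M0.
have -> : b = cst c * b' by rewrite /b' mulrA cc mul1r.
rewrite rpredM ?const_convergent2 //; apply/convergent2P; exists q, 2.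
split=> // n; apply: (submult_inverse (n2P n q0) _ eb).
apply: le_trans qM; apply: (@le_trans _ _ (q / s * nrm2 s n r)).
  apply: wsum_shrink => //; first exact: (sm_ge0 (n1P n s0)).
    by move=> u; apply: wsum_le.
  have r00 : r 0%N 0%N = 0.
    rewrite /r (fpsBE 1 (cst c * a)) /cst fpsCME.
    by rewrite (fpsBE (1 : fps C) (fpsC c * a 0%N)) fpsCME fps1E mulVf ?subrr.
  by apply: wsum_shrink => //; rewrite r00 normr0 mulr0.
by rewrite ler_wpM2l // divr_ge0 ?ltW.
Qed.

(** The restriction of a series in two variables to the line x = l y. *)
Definition fps_line (l : C) (a : fps (fps C)) : fps C :=
  Fps (fun n => \sum_(i < n.+1) l ^+ i * a i (n - i)%N).

Lemma line_convergent1 l (a : fps (fps C)) :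
  a \in @convergent2 R -> fps_line l a \in @convergent1 R.
Proof.
move=> /convergent2P[r [M [r0 ha]]].
have l0 : 0 < 1 + `|l| by rewrite ltr_wpDr.
pose s := r / (1 + `|l|); have s0 : 0 < s by rewrite divr_gt0.
have sr : s <= r by rewrite ler_pdivrMr // ler_peMr ?(ltW r0) // lerDl.
have lsr : `|l| * s <= r.
  by rewrite /s mulrA ler_pdivrMr // mulrC ler_pM2l // lerDr.
clearbody s; apply/convergent1P; exists s, M; split=> // n; apply: le_trans (ha n).
pose F i j := `|a i j| * (`|l| * s) ^+ i * s ^+ j.
have F0 i j : 0 <= F i j.
  have s0' := ltW s0.
  by rewrite /F mulr_ge0 ?exprn_ge0 // mulr_ge0 // exprn_ge0 // mulr_ge0.
apply: (@le_trans _ _ (\sum_(k < n) \sum_(i < k.+1) F i (k - i)%N)).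
  apply: ler_sum => k _; apply: (@le_trans _ _
     ((\sum_(i < k.+1) `|l ^+ i * a i (k - i)%N|) * s ^+ k)).
    by rewrite ler_wpM2r ?exprn_ge0 ?(ltW s0) // ler_norm_sum.
  rewrite mulr_suml; apply: ler_sum => i _.
  have ik : (i <= k)%N by rewrite -ltnS.
  have -> : s ^+ k = s ^+ i * s ^+ (k - i) by rewrite -exprD subnKC.
  rewrite normrM normrX /F exprMn le_eqVlt; apply/orP; left.
  by apply/eqP; rewrite [_ ^+ i * `|a _ _|]mulrC !mulrA.
rewrite sum_antidiagonal; apply: ler_sum => i _.
apply: (@le_trans _ _ (\sum_(j < n) F i j)).
  rewrite (big_ord_widen n (fun j => F i j)) ?leq_subr // big_mkcond.
  by apply: ler_sum => j _; case: ifP.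
rewrite /wsum mulr_suml; apply: ler_sum => j _; rewrite /F mulrAC.
have s0' := ltW s0; have r0' := ltW r0.
apply: ler_pM; rewrite ?mulr_ge0 ?exprn_ge0 ?mulr_ge0 //.
  by rewrite ler_wpM2l // lerXn2r ?nnegrE.
by rewrite lerXn2r ?nnegrE ?mulr_ge0.
Qed.

End Convergence.

(** * Derivations of fraction fields *)

Section FractionDerivation.
Variables (A : idomainType) (d : A -> A).
Hypothesis dP : derivation d.
Local Notation K := {fraction A}.

Lemma frac_reprE (q : K) : q * (\d_(repr q))%:F = (\n_(repr q))%:F.
Proof.
rewrite -{1}[q]reprK; move: (repr q) => r; have d0 := denom_ratioP r.
change (FracField.mul (\pi_(FracField.type A)%qT r) (\d_r)%:F = (\n_r)%:F).
rewrite !piE; apply/eqmodP; rewrite /= FracField.equivfE.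
rewrite /FracField.mulf !numden_Ratio ?mulr1 ?oner_eq0 //.
by rewrite mulrC.
Qed.

Lemma frac_repr (q : K) : exists n m : A, m != 0 /\ q = n%:F / m%:F.
Proof.
have d0 := denom_ratioP (repr q).
exists (\n_(repr q)), (\d_(repr q)); split=> //.
by rewrite -frac_reprE mulfK // tofrac_eq0.
Qed.

(** Written on representatives in order to be convertible to the extension of
    partial derivatives to meromorphic functions. *)
Definition qder (q : K) : K :=
  let n := \n_(repr q) in let m := \d_(repr q) in
  (d n * m - n * d m)%:F / (m ^+ 2)%:F.

Lemma frac_eqP (a b c e : A) : b != 0 -> e != 0 ->
  reflect (a * e = c * b) (a%:F / b%:F == c%:F / e%:F :> K).
Proof.
move=> b0 e0; rewrite eqr_div ?tofrac_eq0 // -!tofracM tofrac_eq.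
exact: eqP.
Qed.

Lemma qder_div (a b : A) : b != 0 ->
  qder (a%:F / b%:F) = (d a * b - a * d b)%:F / (b ^+ 2)%:F.
Proof.
move=> b0; rewrite /qder; set q : K := a%:F / b%:F.
set n := \n_(repr q); set m := \d_(repr q).
have m0 : m != 0 := denom_ratioP (repr q).
have e : n * b = a * m.
  apply/eqP; rewrite -tofrac_eq !tofracM -frac_reprE -/m /q.
  by rewrite mulrAC divfK // tofrac_eq0.
have e' : d n * b + n * d b = d a * m + a * d m by rewrite -!dP.2 e.
clearbody n m; apply/eqP/frac_eqP; rewrite ?expf_neq0 //.
have H : (d n * b + n * d b) * m * b - (d b * m + b * d m) * (n * b) =
         (d a * m + a * d m) * m * b - (d b * m + b * d m) * (a * m).
  by rewrite e e'.
apply: etrans (etrans H _); ring.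
Qed.

Lemma qder_tofrac a : qder a%:F = (d a)%:F.
Proof.
have {1}-> : a%:F = a%:F / 1%:F :> K by rewrite tofrac1 divr1.
rewrite qder_div ?oner_eq0 // (der1 dP) mulr0 subr0 mulr1 expr1n.
by rewrite tofrac1 divr1.
Qed.

Lemma qder_derivation : derivation qder.
Proof.
split=> p q; have [a [b [b0 ->]]] := frac_repr p;
    have [c [e [e0 ->]]] := frac_repr q.
  have -> : a%:F / b%:F + c%:F / e%:F = (a * e + c * b)%:F / (b * e)%:F :> K.
    by rewrite addf_div ?tofrac_eq0 // -!tofracM -tofracD.
  rewrite !qder_div ?mulf_neq0 //.
  rewrite addf_div ?tofrac_eq0 ?expf_neq0 // -!tofracM -tofracD.
  apply/eqP/frac_eqP; rewrite ?mulf_neq0 ?expf_neq0 ?mulf_neq0 //.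
  by rewrite !(dP.1, dP.2); ring.
have -> : a%:F / b%:F * (c%:F / e%:F) = (a * c)%:F / (b * e)%:F :> K.
  by rewrite mulf_div -!tofracM.
rewrite !qder_div ?mulf_neq0 // !mulf_div -!tofracM.
rewrite addf_div ?tofrac_eq0 ?mulf_neq0 ?expf_neq0 // -!tofracM -tofracD.
apply/eqP/frac_eqP; rewrite ?mulf_neq0 ?expf_neq0 ?mulf_neq0 ?expf_neq0 //.
by rewrite !(dP.1, dP.2); ring.
Qed.
End FractionDerivation.

(** * The discrete valuation ring of convergent series in one variable *)

Section OneVariable.
Variable R : realType.
Local Notation C := (R[i]).
Local Notation T := (cps1 R).
Local Notation QT := {fraction T}.
Implicit Types (a b u w : T) (q : QT).

Lemma cps1P a b : (forall n, a n = b n) -> a = b.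
Proof. by move=> ab; apply/val_inj/fpsP. Qed.

Lemma cps1_D a b : series1 (a + b) = series1 a + series1 b.
Proof. exact: (rmorphD val). Qed.
Lemma cps1_N a : series1 (- a) = - series1 a.
Proof. exact: (rmorphN val). Qed.
Lemma cps1_M a b : series1 (a * b) = series1 a * series1 b.
Proof. exact: (rmorphM val). Qed.
Lemma cps1_1 : series1 (1 : T) = 1.
Proof. exact: (rmorph1 val). Qed.
Lemma cps1_0 : series1 (0 : T) = 0.
Proof. exact: (rmorph0 val). Qed.
Lemma cps1_Mn a k : series1 (a *+ k) = series1 a *+ k.
Proof. exact: (rmorphMn val). Qed.
Lemma cps1_X a k : series1 (a ^+ k) = series1 a ^+ k.
Proof. exact: (rmorphXn val). Qed.
Definition cps1E := (cps1_D, cps1_N, cps1_M, cps1_1, cps1_0, cps1_Mn).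

Fact fpsX_convergent1 : fpsX C \in @convergent1 R.
Proof.
apply/convergent1P; exists 1, 1; split=> // n.
exact: (wsum_fpsX (submult_norm C) ltr01).
Qed.

Definition tvar : T := Cps1 fpsX_convergent1.
Definition tshift a : T := Cps1 (fshift_convergent1 (valP a)).
Definition tder a : T := Cps1 (deriv_convergent1 (valP a)).

Lemma tvarM0 a : (tvar * a) 0%N = 0.
Proof. by rewrite cps1E fpsXM0. Qed.
Lemma tvarMS a n : (tvar * a) n.+1 = a n.
Proof. by rewrite cps1E fpsXMS. Qed.
Lemma tvarXM k a n : (tvar ^+ k * a) n = if (n < k)%N then 0 else a (n - k)%N.
Proof. by rewrite cps1_M cps1_X fpsXnM. Qed.
Lemma const1ME c a n : (const1 c * a) n = c * a n.
Proof. by rewrite cps1E fpsCME. Qed.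
Lemma const1_0 : const1 0 = 0 :> T.
Proof. by apply: cps1P => -[|n]. Qed.
Lemma const1_1 : const1 1 = 1 :> T.
Proof. by apply: cps1P => -[|n]. Qed.

Lemma tshiftE a : a = const1 (a 0%N) + tvar * tshift a.
Proof.
apply: cps1P => -[|n]; rewrite cps1_D fpsDE ?tvarM0 ?tvarMS /= ?addr0 ?add0r //.
Qed.

Lemma iter_tshiftE j a i : (iter j tshift a) i = a (j + i)%N.
Proof. by elim: j i => [//|j IH] i; rewrite iterS /= IH addSnnS. Qed.

Lemma tvarX_factor k a : (forall i, (i < k)%N -> a i = 0) ->
  a = tvar ^+ k * iter k tshift a.
Proof.
move=> h; apply: cps1P => n; rewrite tvarXM; case: ltnP => [/h //|kn].
by rewrite iter_tshiftE subnKC.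
Qed.

Lemma tvar_neq0 : tvar != 0.
Proof.
apply/eqP => e; have : tvar 1%N = (0 : T) 1%N by rewrite e.
by rewrite cps1E fps0E /= => /eqP; rewrite oner_eq0.
Qed.

Lemma tvar_adic a : (forall N, exists b, a = tvar ^+ N * b) -> a = 0.
Proof.
move=> h; apply: cps1P => n; have [b ->] := h n.+1.
by rewrite tvarXM ltnSn cps1E fps0E.
Qed.

Lemma cps1_unit a : a 0%N != 0 -> exists b, b * a = 1.
Proof.
move=> a0; have [b ba] := fps_inverse (mulVf a0).
exists (Cps1 (inverse_convergent1 (valP a) ba)).
by apply: val_inj; rewrite rmorphM rmorph1.
Qed.

Lemma tder_derivation : derivation tder.
Proof.
split=> a b; apply/val_inj.
  change (fps_deriv (series1 (a + b)) = series1 (tder a + tder b)).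
  by rewrite !cps1_D (fps_deriv_der _).1.
change (fps_deriv (series1 (a * b)) = series1 (tder a * b + a * tder b)).
by rewrite cps1_D !cps1_M (fps_deriv_der _).2.
Qed.

Lemma tder_const c : tder (const1 c) = 0.
Proof. by apply: cps1P => n; rewrite cps1_0 fps0E /= mul0rn. Qed.
Lemma tder_tvar : tder tvar = 1.
Proof.
by apply: cps1P => n; rewrite cps1_1 fps1E; case: n => [|n] /=; rewrite ?mul0rn.
Qed.

Lemma tvar_tderE a n : (tvar * tder a) n = a n *+ n.
Proof. by case: n => [|n]; rewrite ?tvarM0 ?tvarMS ?mulr0n. Qed.

Lemma ord_factor a : a != 0 -> exists2 u : T, u 0%N != 0 & a = tvar ^+ (ord a) * u.
Proof.
move=> a0; have ex : exists n, a n != 0.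
  apply: fps_exN0 => e; move/eqP: a0; apply; apply: val_inj.
  by change (series1 a = series1 0); rewrite e cps1_0.
rewrite /ord; case: pselect => // e; case: ex_minnP => m am mm.
exists (iter m tshift a); last first.
  apply: tvarX_factor => i im; apply/eqP; apply: contraLR im => ai.
  by rewrite -leqNgt mm.
by rewrite iter_tshiftE addn0.
Qed.

Lemma tvarX_inj n m u w : u 0%N != 0 -> w 0%N != 0 ->
  tvar ^+ n * u = tvar ^+ m * w -> n = m.
Proof.
move=> u0 w0 e; apply/eqP; rewrite eqn_leq; apply/andP; split.
  rewrite leqNgt; apply/negP => lt.
  have := congr1 (fun a : T => a m) e; rewrite !tvarXM ltnn lt subnn => e0.
  by rewrite -e0 eqxx in w0.
rewrite leqNgt; apply/negP => lt.
have := congr1 (fun a : T => a n) e; rewrite !tvarXM ltnn lt subnn => e0.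
by rewrite e0 eqxx in u0.
Qed.

Local Notation tF := (tvar%:F : QT).

Lemma tF_neq0 : tF != 0.
Proof. by rewrite tofrac_eq0 tvar_neq0. Qed.

Lemma tFz (n m : nat) : tF ^ (n%:Z - m%:Z) = tF ^+ n / tF ^+ m.
Proof. by rewrite expfzDr ?tF_neq0 // -exprnN. Qed.

Lemma frac_order q : q != 0 -> exists v (u : T), u 0%N != 0 /\ q = tF ^ v * u%:F.
Proof.
have [a [b [b0 ->]]] := frac_repr q => q0.
have a0 : a != 0 by apply: contraNneq q0 => ->; rewrite tofrac0 mul0r.
have [u u0 ea] := ord_factor a0; have [w w0 eb] := ord_factor b0.
have [w' ww] := cps1_unit w0.
have w'0 : w' 0%N != 0.
  apply/eqP => e; have : (w' * w) 0%N = (1 : T) 0%N by rewrite ww.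
  by rewrite !cps1E fpsM0E e mul0r => /eqP; rewrite eq_sym oner_eq0.
exists ((ord a)%:Z - (ord b)%:Z), (u * w'); split.
  by rewrite cps1E fpsM0E mulf_neq0.
rewrite tFz {1}ea {1}eb !tofracM !tofracXn invfM.
have -> : w%:F^-1 = w'%:F.
  have wF : w%:F != 0 :> QT.
    by rewrite tofrac_eq0; apply: contraNneq w0 => ->; rewrite cps1E fps0E.
  by apply: (mulIf wF); rewrite mulVf // -tofracM ww tofrac1.
by rewrite mulrACA.
Qed.

Lemma val_tE v u : u 0%N != 0 -> val_t (tF ^ v * u%:F) = v%:E.
Proof.
move=> u0; have uF : u != 0 by apply: contraNneq u0 => ->; rewrite cps1E fps0E.
pose q := tF ^ v * u%:F.
have q0 : q != 0.
  by apply: mulf_neq0; [exact: expfz_neq0 tF_neq0 | rewrite tofrac_eq0].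
rewrite -/q.
rewrite /val_t (negPf q0); congr (_%:E).
set n := \n_(repr q); set m := \d_(repr q).
have m0 : m != 0 := denom_ratioP (repr q).
have e : q * m%:F = n%:F := frac_reprE q.
clearbody n m.
have n0 : n != 0.
  rewrite -(tofrac_eq0 n) -e; apply: mulf_neq0; first exact: q0.
  by rewrite tofrac_eq0; exact: m0.
have [un un0 en] := ord_factor n0; have [um um0 em] := ord_factor m0.
set a := ord n in en *; set b := ord m in em *.
have uum : (u * um) 0%N != 0 by rewrite cps1E fpsM0E mulf_neq0.
move: e; rewrite /q en em; case: v {q q0} => v.
  rewrite -exprnP -!tofracXn -!tofracM => /eqP; rewrite tofrac_eq => /eqP e.
  have : tvar ^+ (v + b) * (u * um) = tvar ^+ a * un by rewrite -e exprD mulrACA.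
  by move/(tvarX_inj uum un0) => <-; rewrite PoszD addrK.
rewrite NegzE -exprnN -tofracXn => e.
have X0 : (tvar ^+ v.+1)%:F != 0 :> QT.
  by rewrite tofrac_eq0 expf_neq0 ?tvar_neq0.
have : tvar ^+ b * (u * um) = tvar ^+ (a + v.+1) * un.
  apply/eqP; rewrite -tofrac_eq; apply/eqP.
  have -> : tvar ^+ (a + v.+1) * un = tvar ^+ v.+1 * (tvar ^+ a * un).
    by rewrite exprD; ring.
  rewrite [RHS]tofracM -e -[_ * u%:F * _]mulrA mulVKf // -tofracM.
  by congr (_%:F); ring.
move/(tvarX_inj uum un0) => ->; rewrite PoszD; ring.
Qed.

Lemma val_t_neq0 q v : val_t q = v%:E -> q != 0.
Proof. by move=> e; apply/eqP => q0; move: e; rewrite /val_t q0 eqxx. Qed.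

Lemma val_t_ge0 q v : val_t q = v%:E -> 0 <= v -> exists a, q = a%:F.
Proof.
move=> e v0; have q0 := val_t_neq0 e.
have [w [u [u0 eq]]] := frac_order q0; move: e; rewrite eq val_tE // => -[ew].
move: v0; rewrite -ew; case: w {ew eq} => // n _.
by exists (tvar ^+ n * u); rewrite tofracM tofracXn exprnP.
Qed.

Local Notation D := (qder tder).

(** The coefficient of 1/t.  The denominator is t ^+ m.+1 and not t ^+ m, so
    that the coefficient to be read off has the index m. *)
Definition res q : C :=
  if pselect (exists p : nat * T, q * tF ^+ p.1.+1 = p.2%:F) is left e
  then (projT1 (cid e)).2 (projT1 (cid e)).1 else 0.

Lemma res_unfold q m a : q * tF ^+ m.+1 = a%:F -> res q = a m.
Proof.
move=> e; rewrite /res; case: pselect => [ex|]; last by case; exists (m, a).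
case: cid => -[k b] /= eb; apply/esym.
have : a * tvar ^+ k.+1 = b * tvar ^+ m.+1.
  by apply/eqP; rewrite -tofrac_eq !tofracM !tofracXn -e -eb mulrAC.
move/(congr1 (fun c : T => c (m + k).+1)).
rewrite ![_ * tvar ^+ _]mulrC !tvarXM ltnS ltnNge leq_addl ltnS ltnNge leq_addr /=.
by rewrite !subSS addnK addKn.
Qed.

Lemma frac_denominator q : exists m a, q * tF ^+ m.+1 = a%:F.
Proof.
have [->|q0] := eqVneq q 0; first by exists 0%N, 0; rewrite mul0r tofrac0.
have [[n|n] [u [u0 ->]]] := frac_order q0.
  exists 0%N, (tvar ^+ n * u * tvar).
  by rewrite expr1 !tofracM tofracXn exprnP.
have n0 : tF ^+ n.+1 != 0 by apply: expf_neq0; exact: tF_neq0.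
by exists n, u; rewrite NegzE -exprnN mulrAC (mulVf n0) mul1r.
Qed.

Lemma resD q q' : res (q + q') = res q + res q'.
Proof.
have [m [a e]] := frac_denominator q; have [k [b e']] := frac_denominator q'.
rewrite (res_unfold e) (res_unfold e').
rewrite (@res_unfold _ (m + k.+1)%N (a * tvar ^+ k.+1 + b * tvar ^+ m.+1)).
  rewrite cps1_D fpsDE ![_ * tvar ^+ _]mulrC !tvarXM.
  have -> : (m + k.+1 < k.+1)%N = false by lia.
  have -> : (m + k.+1 < m.+1)%N = false by lia.
  by rewrite addnK -addSnnS addKn.
rewrite tofracD !tofracM !tofracXn -e -e' mulrDl; congr (_ + _).
  by rewrite -mulrA -exprD addSn.
by rewrite -mulrA -exprD; congr (_ * tF ^+ _); lia.
Qed.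

Lemma resZ c q : res ((const1 c)%:F * q) = c * res q.
Proof.
have [m [a e]] := frac_denominator q; rewrite (res_unfold e).
rewrite (@res_unfold _ m (const1 c * a)); first by rewrite const1ME.
by rewrite -mulrA e tofracM.
Qed.

Lemma res_polar a m : res (a%:F / tF ^+ m.+1) = a m.
Proof.
have n0 : tF ^+ m.+1 != 0 by apply: expf_neq0; exact: tF_neq0.
by apply: res_unfold; rewrite (divfK n0).
Qed.

Lemma res_simple_pole a : res (a%:F / tF) = a 0%N.
Proof. by have := res_polar a 0; rewrite expr1. Qed.

Lemma res_tofrac a : res a%:F = 0.
Proof.
rewrite (@res_unfold _ 0%N (tvar * a)) ?tvarM0 //.
by rewrite expr1 -tofracM mulrC.
Qed.

Lemma res_der q : res (D q) = 0.
Proof.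
have [m [a e]] := frac_denominator q; have DP := qder_derivation tder_derivation.
rewrite (@res_unfold _ m.+1 (tvar * tder a - a *+ m.+1)).
  by rewrite cps1E fpsDE cps1_N fpsNE cps1_Mn fpsMnE tvar_tderE subrr.
have : D (q * tF ^+ m.+1) = (tder a)%:F by rewrite e qder_tofrac //; exact: tder_derivation.
rewrite DP.2 (derX DP) qder_tofrac; last exact: tder_derivation.
rewrite tder_tvar tofrac1 mul1r => e'.
rewrite tofracB tofracM -e' tofracMn -e !exprS; ring.
Qed.

(** Termwise integration: the residue is the only obstruction to having a
    primitive. *)
Lemma frac_primitive q : res q = 0 -> exists g, q = D g.
Proof.
have [m [a e]] := frac_denominator q; rewrite (res_unfold e) => am.
(* q = a / t^(m+1), so the coefficient a_i belongs to t^(i-m-1) and becomes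
   a_i / (i - m) in the primitive; at i = m the coefficient is 0. *)
pose k i : C := (i%:Z - m%:Z)%:~R.
have bc : Fps (fun i => a i / k i) \in @convergent1 R.
  apply: (@convergent1_dominated _ a _ 1 _ (valP a)) => i /=.
  rewrite mul1r normrM normfV.
  have [->|im] := eqVneq i m; first by rewrite am normr0 mul0r.
  have k1 : 1 <= `|k i|.
    by rewrite /k -intr_norm -[1]/(1%:~R) ler_int -gtz0_ge1 normr_gt0 subr_eq0.
  rewrite ler_piMr // invf_le1 //; exact: lt_le_trans k1.
have tm0 : tvar ^+ m != 0 by rewrite expf_neq0 ?tvar_neq0.
exists ((Cps1 bc)%:F / (tvar ^+ m)%:F).
rewrite qder_div //; last exact: tder_derivation.
set b := Cps1 bc.
have eb : tvar * tder b - b *+ m = a.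
  apply: cps1P => i; rewrite cps1_D fpsDE cps1_N fpsNE cps1_Mn fpsMnE tvar_tderE /=.
  rewrite -mulr_natr -[_ *+ m]mulr_natr -mulrBr.
  have [->|im] := eqVneq i m; first by rewrite am !mul0r.
  have k0 : k i != 0 by rewrite /k intr_eq0 subr_eq0.
  have -> : i%:R - m%:R = k i by rewrite /k intrB.
  by rewrite divfK.
have tX : tvar * tder (tvar ^+ m) = tvar ^+ m *+ m.
  case: (m) => [|n]; first by rewrite expr0 (der1 tder_derivation) mulr0.
  by rewrite (derX tder_derivation) tder_tvar mul1r mulrnAr -exprS.
have d0 : ((tvar ^+ m) ^+ 2)%:F != 0 :> QT by rewrite tofrac_eq0 expf_neq0.
have t0 : tF ^+ m.+1 != 0 by apply: expf_neq0; exact: tF_neq0.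
apply: (mulIf t0); rewrite e; apply: (mulIf d0).
rewrite [RHS]mulrAC (divfK d0) -tofracXn -!tofracM; congr (_%:F).
rewrite -{1}eb [tvar ^+ m.+1]exprS.
transitivity ((tvar * tder b * tvar ^+ m - b * (tvar ^+ m *+ m)) * tvar ^+ m).
  ring.
rewrite -tX; ring.
Qed.

Lemma frac_residue_split q : exists g, q = (const1 (res q))%:F / tF + D g.
Proof.
have [|g eg] := @frac_primitive (q - (const1 (res q))%:F / tF).
  rewrite -mulNr -tofracN resD res_simple_pole cps1_N fpsNE.
  exact: subrr.
by exists g; rewrite -eg addrC subrK.
Qed.

End OneVariable.

(** * Germs in two variables and their expansion along a line *)

Section TwoVariables.
Variable R : realType.
Local Notation C := (R[i]).
Local Notation T := (cps1 R).
Local Notation QT := {fraction T}.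
Local Notation S := (cps2 R).
Local Notation D := (qder (@tder R)).
Implicit Types (a b h : S) (c : T).

Lemma cps2P a b : (forall i j, a i j = b i j) -> a = b.
Proof. by move=> ab; apply/val_inj/fpsP => i; apply: fpsP => j; apply: ab. Qed.

Lemma cps2_D a b : series2 (a + b) = series2 a + series2 b.
Proof. exact: (rmorphD val). Qed.
Lemma cps2_N a : series2 (- a) = - series2 a.
Proof. exact: (rmorphN val). Qed.
Lemma cps2_M a b : series2 (a * b) = series2 a * series2 b.
Proof. exact: (rmorphM val). Qed.
Lemma cps2_1 : series2 (1 : S) = 1.
Proof. exact: (rmorph1 val). Qed.
Lemma cps2_0 : series2 (0 : S) = 0.
Proof. exact: (rmorph0 val). Qed.

Lemma cps2_DE a b i j : (a + b) i j = a i j + b i j.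
Proof. by rewrite cps2_D. Qed.

Lemma cps2_BE a b i j : (a - b) i j = a i j - b i j.
Proof. by rewrite cps2_D cps2_N. Qed.

Lemma cps2_unit a : a 0%N 0%N != 0 -> a \is a GRing.unit.
Proof.
move=> a0; have [u ua] := fps_inverse (mulVf a0).
have [b ba] := fps_inverse ua.
apply/unitrP; exists (Cps2 (inverse_convergent2 (valP a) ba)).
by split; [|rewrite mulrC]; apply: val_inj; rewrite rmorphM rmorph1.
Qed.

Lemma cps2_coef0M a b : (a * b) 0%N 0%N = a 0%N 0%N * b 0%N 0%N.
Proof. by rewrite cps2_M fpsM0E fpsM0E. Qed.

Lemma pdx_derivation : derivation (@pdx R).
Proof.
split=> a b; apply/val_inj.
  change (fps_deriv (series2 (a + b)) = series2 (pdx a + pdx b)).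
  by rewrite !cps2_D (fps_deriv_der _).1.
change (fps_deriv (series2 (a * b)) = series2 (pdx a * b + a * pdx b)).
by rewrite cps2_D !cps2_M (fps_deriv_der _).2.
Qed.

Lemma pdy_derivation : derivation (@pdy R).
Proof.
split=> a b; apply/val_inj; apply: fpsP => i.
  change (fps_deriv (series2 (a + b) i) = series2 (pdy a + pdy b) i).
  by rewrite !cps2_D !fpsDE (fps_deriv_der _).1.
change (fps_deriv (series2 (a * b) i) = series2 (pdy a * b + a * pdy b) i).
rewrite cps2_D !cps2_M fpsDE !fpsME -big_split.
have dP := fps_deriv_der C.
elim/big_rec2: _ => [|k u v _ <-]; first exact: (der0 dP).
by rewrite dP.1 dP.2.
Qed.

Local Notation x := (coord_x R).
Local Notation y := (coord_y R).

Lemma cps2_0E i j : (0 : S) i j = 0.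
Proof. by rewrite cps2_0 fps0E fps0E. Qed.

Lemma pdx_x : pdx x = 1.
Proof.
apply: cps2P => i j; rewrite cps2_1 fps1E /= fpsMnE.
case: i => [|i]; first by rewrite mulr1n.
by rewrite mulr0n !fps0E mul0rn.
Qed.
Lemma pdx_y : pdx y = 0.
Proof. by apply: cps2P => i j; rewrite cps2_0E [LHS]/= fpsMnE fps0E mul0rn. Qed.
Lemma pdx_const k : pdx (const2 k : S) = 0.
Proof. by apply: cps2P => i j; rewrite cps2_0E [LHS]/= fpsMnE fps0E mul0rn. Qed.
Lemma pdy_x : pdy x = 0.
Proof.
apply: cps2P => i j; rewrite cps2_0E [LHS]/=.
by case: i => [|[|i]]; rewrite ?fps0E ?fps1E mul0rn.
Qed.
Lemma pdy_y : pdy y = 1.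
Proof.
apply: cps2P => i j; rewrite cps2_1 fps1E [LHS]/=; case: i => [|i].
  by case: j => [|j]; rewrite /= ?mulr1n ?mul0rn.
by rewrite mulr0n !fps0E mul0rn.
Qed.
Lemma pdy_const k : pdy (const2 k : S) = 0.
Proof.
apply: cps2P => i j; rewrite cps2_0E [LHS]/=.
by case: i => [|i]; rewrite /= ?fps0E mul0rn.
Qed.

Lemma pdx_pdy a : pdx (pdy a) = pdy (pdx a).
Proof. by apply: cps2P => i j; rewrite /= fpsMnE /= fpsMnE mulrnAC. Qed.

Definition xshift a : S := Cps2 (fshift_convergent2 (valP a)).
Definition xslice a : T := Cps1 (slice_convergent1 (valP a)).
Definition in_y c : S := Cps2 (fpsC_convergent2 (valP c)).
Definition in_x c : S := Cps2 (fpsmap_convergent2 (valP c)).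

Lemma xM_coef a i : (x * a) i = if i is i'.+1 then a i' else 0.
Proof. by rewrite cps2_M; case: i => [|i]; rewrite ?fpsXM0 ?fpsXMS. Qed.
Lemma yM_coef a i j : (y * a) i j = if j is j'.+1 then a i j' else 0.
Proof. by rewrite cps2_M fpsCME; case: j => [|j]; rewrite ?fpsXM0 ?fpsXMS. Qed.
Lemma const2M k a i j : (const2 k * a) i j = k * a i j.
Proof. by rewrite cps2_M fpsCME fpsCME. Qed.

Lemma in_x_shift c : in_x c = const2 (c 0%N) + x * in_x (tshift c).
Proof.
apply: cps2P => i j; rewrite cps2_DE xM_coef.
by case: i j => [|i] [|j] /=; rewrite ?addr0 ?add0r.
Qed.
Lemma in_y_shift c : in_y c = const2 (c 0%N) + y * in_y (tshift c).
Proof.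
apply: cps2P => i j; rewrite cps2_DE yM_coef.
by case: i j => [|i] [|[|j]]; rewrite /= ?addr0 ?add0r.
Qed.

Lemma cps2_decomp h : exists h1 h2, h = const2 (h 0%N 0%N) + x * h1 + y * h2.
Proof.
exists (xshift h), (in_y (tshift (xslice h))).
have {1}-> : h = x * xshift h + in_y (xslice h).
  apply: cps2P => i j; rewrite cps2_DE xM_coef.
  by case: i j => [|i] [|j] /=; rewrite ?addr0 ?add0r.
by rewrite in_y_shift addrA [x * _ + _]addrC.
Qed.

Section Shear.
Variable l : C.

Definition line a : T := Cps1 (line_convergent1 l (valP a)).
(** The derivation along the lines x - l y = const. *)
Definition line_der a : S := const2 l * pdx a + pdy a.

Lemma line_der_derivation : derivation line_der.
Proof.
split=> a b; rewrite /line_der !(pdx_derivation.1, pdx_derivation.2,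
  pdy_derivation.1, pdy_derivation.2); ring.
Qed.

Lemma line_derE a : tder (line a) = line (line_der a).
Proof.
apply: cps1P => n.
transitivity ((\sum_(i < n.+2) l ^+ i * a i (n.+1 - i)%N) *+ n.+1); first by [].
transitivity (\sum_(i < n.+1) (l ^+ i * (l * (a i.+1 (n - i)%N *+ i.+1)) +
    l ^+ i * (a i (n - i).+1 *+ (n - i).+1))); last first.
  by apply: eq_bigr => i _; rewrite cps2_DE const2M mulrDr /= fpsMnE.
rewrite -sumrMnl big_split /=.
have E (i : 'I_n.+2) : l ^+ i * a i (n.+1 - i)%N *+ n.+1 =
    l ^+ i * (a i (n.+1 - i)%N *+ i) + l ^+ i * (a i (n.+1 - i)%N *+ (n.+1 - i)).
  by rewrite -mulrDr -mulrnDr subnKC ?mulrnAr // -ltnS.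
rewrite (eq_bigr _ (fun i _ => E i)) big_split /=; congr (_ + _).
  rewrite big_ord_recl mulr0n mulr0 add0r; apply: eq_bigr => i _.
  by rewrite /= subSS exprSr mulrA.
rewrite big_ord_recr /= subnn mulr0n mulr0 addr0; apply: eq_bigr => i _.
by rewrite subSn // -ltnS.
Qed.

Lemma line_zmod : zmod_morphism line.
Proof.
move=> a b; apply: cps1P => n.
transitivity (\sum_(i < n.+1) l ^+ i * (a - b) i (n - i)%N); first by [].
rewrite cps1_D cps1_N fpsBE [RHS]/= -sumrB.
by apply: eq_bigr => i _; rewrite cps2_BE mulrBr.
Qed.
HB.instance Definition _ := GRing.isZmodMorphism.Build S T line line_zmod.

Lemma line_coef0 a : line a 0%N = a 0%N 0%N.
Proof. by rewrite /= big_ord1 expr0 mul1r. Qed.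

Lemma line_const k : line (const2 k) = const1 k.
Proof.
have z i j : (const2 k : S) i.+1 j = 0 by exact: fps0E.
apply: cps1P => n; transitivity ((const2 k : S) 0%N n); last by [].
transitivity (\sum_(i < n.+1) l ^+ i * (const2 k : S) i (n - i)%N); first by [].
rewrite big_ord_recl expr0 mul1r subn0 big1 ?addr0 // => i _.
by rewrite lift0 z mulr0.
Qed.

Lemma line_monoid : monoid_morphism line.
Proof.
split.
  by rewrite -[RHS]const1_1 -line_const; congr line; apply: cps2P => i j; rewrite cps2_1.
move=> a b; apply: val_inj; rewrite [RHS]cps1_M.
apply: (@taylor_multiplicative _ _ line_der (fun a => series1 (line a))).
- exact: line_der_derivation.
- by move=> u n /eqP; rewrite mulrn_eq0 /= => /eqP.
- by move=> u v; rewrite raddfD cps1_D.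
- by move=> u v; rewrite !line_coef0 cps2_coef0M.
- by move=> u; rewrite -line_derE.
Qed.
HB.instance Definition _ := GRing.isMonoidMorphism.Build S T line line_monoid.

Lemma line_y : line y = tvar R.
Proof.
have z i j : y i.+1 j = 0 by exact: fps0E.
apply: cps1P => n; transitivity (y 0%N n); last by [].
transitivity (\sum_(i < n.+1) l ^+ i * y i (n - i)%N); first by [].
rewrite big_ord_recl expr0 mul1r subn0 big1 ?addr0 // => i _.
by rewrite lift0 z mulr0.
Qed.

Lemma line_x : line x = const1 l * tvar R.
Proof.
have z0 j : x 0%N j = 0 by exact: fps0E.
have z i j : x i.+2 j = 0 by exact: fps0E.
apply: cps1P => n; rewrite const1ME.
transitivity (\sum_(i < n.+1) l ^+ i * x i (n - i)%N); first by [].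
rewrite big_ord_recl z0 mulr0 add0r.
case: n => [|n]; first by rewrite big_ord0 mulr0.
rewrite big_ord_recl expr1 big1 ?addr0.
  by rewrite lift0 subSS subn0; case: n => [|n].
by move=> i _; rewrite !lift0 z mulr0.
Qed.

Definition zcoord : S := x - const2 l * y.

Lemma line_z : line zcoord = 0.
Proof. by rewrite rmorphB rmorphM /= line_x line_y line_const subrr. Qed.

Lemma pdx_z : pdx zcoord = 1.
Proof.
have dP := pdx_derivation.
by rewrite (derB dP) dP.2 pdx_x pdx_const pdx_y mul0r mulr0 addr0 subr0.
Qed.

Lemma pdy_z : pdy zcoord = - const2 l.
Proof.
have dP := pdy_derivation.
by rewrite (derB dP) dP.2 pdy_x pdy_const pdy_y mul0r mulr1 !add0r.
Qed.

Lemma line_der_iter a k : iter k (@pdx R) (line_der a) = line_der (iter k (@pdx R) a).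
Proof.
elim: k => [//|k IH]; rewrite !iterS IH /line_der.
by rewrite pdx_derivation.1 pdx_derivation.2 pdx_const mul0r add0r pdx_pdy.
Qed.

(** The germ a(x + l y, y), by Taylor's formula in x.  The coefficients are
    taken in the fractions of C{y} so that germs that do not vanish on the
    line x = l y become invertible. *)
Definition shear a : fps QT :=
  Fps (fun k => (const1 (k`!%:R^-1) * line (iter k (@pdx R) a))%:F).

Lemma shear0 a : shear a 0%N = (line a)%:F.
Proof. by rewrite /= invr1 const1_1 mul1r. Qed.

Lemma shear_pdx a : fps_deriv (shear a) = shear (pdx a).
Proof.
have c k : (k.+1)`!%:R^-1 *+ k.+1 = k`!%:R^-1 :> C.
  by rewrite -[LHS]mulr_natr factS natrM invfM mulrAC mulVf ?mul1r // pnatr_eq0.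
apply: fpsP => k; rewrite /= -tofracMn -mulrnAl -iterSr; congr (_ * _)%:F.
by apply: cps1P => n; rewrite cps1_Mn fpsMnE -(c k); case: n => [|n] //=; rewrite mul0rn.
Qed.

Lemma shear_line_der a : Fps (fun k => D (shear a k)) = shear (line_der a).
Proof.
have dP := tder_derivation R.
apply: fpsP => k; rewrite /= (qder_tofrac dP) dP.2 tder_const mul0r add0r.
by rewrite line_derE line_der_iter.
Qed.

Lemma shear_zmod : zmod_morphism shear.
Proof.
move=> a b; apply: fpsP => k; rewrite fpsBE /= -tofracB -mulrBr -rmorphB.
congr (_ * line _)%:F; elim: k => [//|k IH].
by rewrite !iterS IH (derB pdx_derivation).
Qed.
HB.instance Definition _ := GRing.isZmodMorphism.Build S (fps QT) shear shear_zmod.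

Lemma frac_torsion_free (q : QT) n : q *+ n.+1 = 0 -> q = 0.
Proof.
have [a [b [b0 ->]]] := frac_repr q.
rewrite -mulrnAl -tofracMn => /eqP; rewrite mulf_eq0 invr_eq0 !tofrac_eq0 (negPf b0) orbF.
move=> /eqP e; suff -> : a = 0 by rewrite tofrac0 mul0r.
apply: cps1P => i; have : (a *+ n.+1) i = (0 : T) i by rewrite e.
by rewrite cps1_Mn fpsMnE cps1_0 fps0E => /eqP; rewrite mulrn_eq0 /= => /eqP.
Qed.

Lemma shear_monoid : monoid_morphism shear.
Proof.
split.
  apply: fpsP => -[|k]; first by rewrite shear0 rmorph1.
  rewrite fps1E /= -iterS iterSr (der1 pdx_derivation).
  have -> : iter k (@pdx R) 0 = 0.
    by elim: k => [//|k IH]; rewrite iterS IH (der0 pdx_derivation).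
  by rewrite rmorph0 mulr0 tofrac0.
apply: taylor_multiplicative pdx_derivation frac_torsion_free _ _ shear_pdx.
  by move=> a b; rewrite raddfD.
by move=> a b; rewrite !shear0 rmorphM tofracM.
Qed.
HB.instance Definition _ := GRing.isMonoidMorphism.Build S (fps QT) shear shear_monoid.

Lemma shear_z : shear zcoord = fpsX QT.
Proof.
apply: fpsP => -[|k]; first by rewrite shear0 line_z tofrac0.
have := congr1 (fun g : fps QT => g k) (shear_pdx zcoord).
rewrite pdx_z rmorph1 fps1E /= => e.
by case: k e => [|k]; [rewrite mulr1n | move/frac_torsion_free].
Qed.

Lemma shear_const k : shear (const2 k) = fpsC (const1 k)%:F.
Proof.
apply: fpsP => -[|n]; first by rewrite shear0 line_const.
rewrite /= -iterS iterSr pdx_const.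
have -> : iter n (@pdx R) 0 = 0.
  by elim: n => [//|n IH]; rewrite iterS IH (der0 pdx_derivation).
by rewrite rmorph0 mulr0 tofrac0.
Qed.

End Shear.

(** A nonzero germ is nonzero on all but finitely many of the lines
    x = l y, since its homogeneous components are polynomials in l. *)
Lemma exists_line h : h != 0 -> exists l, line l h != 0.
Proof.
move=> h0; apply: contrapT => /forallNP H.
have lz l : line l h = 0.
  by apply/eqP; case: eqP (H l) => // _ []; rewrite eqxx.
move/eqP: h0; apply; apply: cps2P => i j; rewrite cps2_0E.
pose n := (i + j)%N; pose P : {poly C} := \poly_(k < n.+1) h k (n - k)%N.
have -> : h i j = P`_i by rewrite coef_poly ltnS leq_addr addKn.
suff -> : P = 0 by rewrite coef0.
apply/eqP/negP => /negP P0.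
pose rs : seq C := [seq k%:R | k <- iota 0 (size P)].
have := @max_poly_roots _ P rs P0; rewrite size_map size_iota ltnn.
move=> H'; suff : false by []; apply: H'.
  apply/allP => r _; apply/rootP; rewrite horner_poly.
  transitivity (line r h n); last by rewrite lz cps1_0 fps0E.
  by apply: eq_bigr => k _; rewrite mulrC.
rewrite map_inj_uniq ?iota_uniq // => k1 k2 /eqP.
by rewrite eqr_nat => /eqP.
Qed.

End TwoVariables.

(** * The iterated residue along a line *)

Section IteratedResidue.
Variable R : realType.
Local Notation C := (R[i]).
Local Notation T := (cps1 R).
Local Notation QT := {fraction T}.
Local Notation S := (cps2 R).
Local Notation D := (qder (@tder R)).
Implicit Types (a b h : S) (g : fps QT).

Definition fps_res g : fps C := Fps (fun k => res (g k)).
Definition fps_coef_der g : fps QT := Fps (fun k => D (g k)).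

Let DP : derivation D := qder_derivation (@tder_derivation R).

Lemma fps_resD g g' : fps_res (g + g') = fps_res g + fps_res g'.
Proof. by apply: fpsP => k; rewrite /= resD. Qed.

Lemma res0 : res (0 : QT) = 0.
Proof. by rewrite -tofrac0 res_tofrac. Qed.

Lemma resMn (q : QT) n : res (q *+ n) = res q *+ n.
Proof. by elim: n => [|n IH]; rewrite ?mulr0n ?res0 // !mulrS resD IH. Qed.

Lemma fps_res_deriv g : fps_res (fps_deriv g) = fps_deriv (fps_res g).
Proof. by apply: fpsP => k; rewrite /= resMn. Qed.

Lemma fps_res_coef_der g : fps_res (fps_coef_der g) = 0.
Proof. by apply: fpsP => k; rewrite fps0E [LHS]/= res_der. Qed.

Lemma fps_resN g : fps_res (- g) = - fps_res g.
Proof.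
apply: (@addrI _ (fps_res g)); rewrite -fps_resD !subrr.
by apply: fpsP => k; rewrite [RHS]fps0E; change (res ((0 : fps QT) k) = 0); rewrite fps0E res0.
Qed.

Lemma fps_coef_der_derivation : derivation fps_coef_der.
Proof.
split=> a b; apply: fpsP => k; first by rewrite /= DP.1.
rewrite fpsDE (fpsME (fps_coef_der a) b) (fpsME a (fps_coef_der b)).
rewrite -big_split /=.
elim/big_rec2: _ => [|i u v _ <-]; first by rewrite (der0 DP).
by rewrite DP.1 DP.2.
Qed.

Lemma coef_der_deriv g : fps_coef_der (fps_deriv g) = fps_deriv (fps_coef_der g).
Proof.
have DMn (q : QT) n : D (q *+ n) = D q *+ n.
  by elim: n => [|n IH]; rewrite ?mulr0n ?(der0 DP) // !mulrS DP.1 IH.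
by apply: fpsP => k; exact: DMn.
Qed.

Lemma lineM l a b : line l (a * b) = line l a * line l b.
Proof. exact: rmorphM. Qed.
Lemma lineX l a n : line l (a ^+ n) = line l a ^+ n.
Proof. exact: rmorphXn. Qed.
Lemma shearM l a b : shear l (a * b) = shear l a * shear l b.
Proof. exact: rmorphM. Qed.

Variables (l : C) (f : S).
Hypothesis f_line : line l f != 0.

Let invf_ex : exists g, g * shear l f = 1.
Proof.
apply: (@fps_inverse _ _ (line l f)%:F^-1).
by rewrite shear0 mulVf // tofrac_eq0.
Qed.
Definition shear_inv : fps QT := projT1 (cid invf_ex).
Lemma shear_invE : shear_inv * shear l f = 1.
Proof. exact: projT2 (cid invf_ex). Qed.

(** The residue in y of a germ divided by f, expanded in powers of zcoord. *)
Definition line_res h : fps C := fps_res (shear l h * shear_inv).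

Lemma line_resD a b : line_res (a + b) = line_res a + line_res b.
Proof. by rewrite /line_res rmorphD mulrDl fps_resD. Qed.

Lemma line_resB a b : line_res (a - b) = line_res a - line_res b.
Proof. by rewrite /line_res rmorphB mulrBl fps_resD fps_resN. Qed.

Lemma line_res_const c a k : line_res (const2 c * a) k = c * line_res a k.
Proof.
change (res ((shear l (const2 c * a) * shear_inv) k) =
        c * res ((shear l a * shear_inv) k)).
by rewrite (shearM l) shear_const -mulrA fpsCME resZ.
Qed.

Lemma line_res_f a : line_res (f * a) = 0.
Proof.
rewrite /line_res rmorphM mulrC mulrA shear_invE mul1r.
by apply: fpsP => k; rewrite fps0E [LHS]/= res_tofrac.
Qed.

Lemma line_res_z a : line_res (zcoord l * a) = fpsX C * line_res a.
Proof.
rewrite /line_res shearM shear_z -mulrA; apply: fpsP => k.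
change (res ((fpsX QT * (shear l a * shear_inv)) k) =
        (fpsX C * fps_res (shear l a * shear_inv)) k).
by case: k => [|k]; rewrite ?fpsXM0 ?fpsXMS ?res0.
Qed.

(** Divided by f, the bracket of b and f is the derivative in zcoord of
    b (E f) / f minus the derivative along the line of b f_x / f, where
    E = line_der l; the latter has no residue. *)
Lemma line_res_bracket b :
  line_res (pdx b * pdy f - pdy b * pdx f) =
  fps_deriv (line_res (b * line_der l f)).
Proof.
pose d1 := @fps_deriv QT; pose d2 := fps_coef_der.
have d1P : derivation d1 := fps_deriv_der QT.
have d2P : derivation d2 := fps_coef_der_derivation.
pose B := shear l b; pose F := shear l f; pose G := shear_inv.
have GF : G * F = 1 := shear_invE.
have dG (d : fps QT -> fps QT) : derivation d -> d G = - (G * G * d F).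
  move=> dP; have e : d G * F + G * d F = 0 by rewrite -dP.2 GF (der1 dP).
  have -> : d G = (d G * F + G * d F) * G - G * G * d F.
    by rewrite mulrDl -[d G * F * G]mulrA [F * G]mulrC GF; ring.
  by rewrite e mul0r sub0r.
have e12 : d1 (d2 F) = d2 (d1 F) by rewrite /d2 /d1 -coef_der_deriv.
have -> : pdx b * pdy f - pdy b * pdx f =
    pdx b * line_der l f - line_der l b * pdx f by rewrite /line_der; ring.
rewrite /line_res rmorphB !rmorphM /= -!shear_pdx -!shear_line_der.
rewrite -/B -/F -/G -[Fps _]/(d2 F) -[Fps (fun k => D (B k))]/(d2 B).
rewrite -/(d1 B) -/(d1 F) -fps_res_deriv -/(d1 _).
have -> : (d1 B * d2 F - d2 B * d1 F) * G = d1 (B * d2 F * G) - d2 (B * d1 F * G).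
  by rewrite !(d1P.2, d2P.2) (dG _ d1P) (dG _ d2P) -/d1 -/d2 e12; ring.
by rewrite fps_resD fps_resN fps_res_coef_der subr0.
Qed.

(** On the line f is t^n times a unit v, and the residues of a y^i / f for
    i < n are the first n coefficients of a / v. *)
Lemma line_res_nondegenerate a :
  (forall h, line_res (a * h) 0%N = 0) -> exists c, line l a = line l f * c.
Proof.
move=> H; have [v v0 ef] := ord_factor f_line; set n := ord _ in ef.
have [w wv] := cps1_unit v0; pose u := line l a * w.
have G0 : shear_inv 0%N = (line l f)%:F^-1.
  have e : (shear_inv * shear l f) 0%N = 1 by rewrite shear_invE.
  have F0 : (line l f)%:F != 0 :> QT by rewrite tofrac_eq0.
  apply: (mulIf F0); rewrite (mulVf F0) -e.
  by rewrite fpsM0E shear0.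
have ui i : (i < n)%N -> u i = 0.
  move=> lin; rewrite -(H (coord_y R ^+ (n - i.+1))).
  change (u i = res ((shear l (a * coord_y R ^+ (n - i.+1)) * shear_inv) 0%N)).
  (* the factor y^(n-i-1) leaves u / t^(i+1), whose residue is u i *)
  rewrite -(res_polar u i); congr res.
  rewrite fpsM0E shear0 G0 lineM lineX line_y ef.
  have tN k : (tvar R)%:F ^+ k != 0 :> QT by apply: expf_neq0; exact: tF_neq0.
  have vF : v%:F != 0 :> QT.
    by rewrite tofrac_eq0; apply: contraNneq v0 => ->; rewrite cps1_0 fps0E.
  have wF : w%:F = v%:F^-1.
    by apply: (mulIf vF); rewrite (mulVf vF) -tofracM wv tofrac1.
  rewrite /u !tofracM !tofracXn wF.
  have -> : n = (i.+1 + (n - i.+1))%N by rewrite subnKC.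
  rewrite addKn exprD !invfM; set X := _ ^+ i.+1; set Y := _ ^+ (n - i.+1).
  have Y0 : Y != 0 := tN _.
  have e (a1 b1 c1 d1 e1 : QT) : a1 * b1 * (c1 * d1 * e1) = a1 * e1 * c1 * (b1 * d1).
    ring.
  by rewrite e (mulfV Y0) mulr1.
exists (iter n (@tshift R) u); rewrite ef.
have -> : tvar R ^+ n * v * iter n (@tshift R) u = v * u.
  by rewrite {2}(tvarX_factor ui); ring.
by rewrite /u mulrCA [v * w]mulrC wv mulr1.
Qed.

End IteratedResidue.

(** * Division by a series in one variable *)

Section Preparation.
Variable R : realType.
Local Notation C := (R[i]).
Local Notation T := (cps1 R).
Local Notation nrm1 r n := (wsum (fun z : C => `|z|) r n).
Local Notation t := (tvar R).

Lemma tshift_truncation n (u : T) :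
  u = \sum_(k < n) const1 (u k) * t ^+ k + t ^+ n * iter n (@tshift R) u.
Proof.
elim: n => [|n IH]; first by rewrite big_ord0 add0r mul1r.
rewrite big_ord_recr /= {1}IH -addrA; congr (_ + _).
rewrite {1}[iter n _ u]tshiftE.
have -> : iter n (@tshift R) u 0%N = u n by rewrite iter_tshiftE addn0.
by rewrite mulrDr exprSr; ring.
Qed.

Section Division.
Variables (X w : T) (n : nat).
Let step (u : T) : T := w * iter n (@tshift R) u.

(** Division by t^n multiplies the norm on the disc of radius r by at most
    r^-n, so the iterates of step grow at most geometrically. *)
Lemma step_convergent (u : T) k :
  Fps (fun i => (iter i step u) k) \in @convergent1 R.
Proof.
have /convergent1P[r1 [K [r10 hK]]] := valP w.
have /convergent1P[r2 [M [r20 hM]]] := valP u.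
have [r [r0 rr1 rr2]] := common_radius r10 r20.
have nP := submult_norm C.
have n1P m := submult_wsum nP r0 m.
have K0 : 0 <= K by have := hK 0%N; rewrite /wsum big_ord0.
have {}hK m : nrm1 r m w <= K + 1.
  apply: (@le_trans _ _ (nrm1 r1 m w)); first exact: wsum_le.
  by apply: le_trans (hK m) _; rewrite lerDl.
have {}hM m : nrm1 r m u <= M.
  by apply: le_trans (hM m); apply: wsum_le.
have K1 : 0 < K + 1 by rewrite ltr_wpDl.
have shiftB B (a : T) i : (forall m, nrm1 r m a <= B) ->
    forall m, nrm1 r m (iter i (@tshift R) a) <= (r^-1) ^+ i * B.
  move=> hB; elim: i => [|i IH] m; first by rewrite mul1r.
  rewrite iterS exprS -mulrA; apply: le_trans (wsum_shift _ _ _ r0) _ => //.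
  by rewrite ler_wpM2l // invr_ge0 ltW.
pose q := (K + 1) * (r^-1) ^+ n.
have q0 : 0 < q by rewrite mulr_gt0 // exprn_gt0 // invr_gt0.
have stepB i m : nrm1 r m (iter i step u) <= q ^+ i * M.
  elim: i m => [|i IH] m; first by rewrite mul1r.
  rewrite iterS {1}/step cps1_M; apply: le_trans (sm_M (n1P m) _ _) _.
  rewrite exprS /q -!mulrA; apply: ler_pM; rewrite ?(sm_ge0 (n1P m)) //.
  exact: shiftB.
apply: (@convergent1_geometric _ _ ((r ^+ k)^-1 * M) q q0) => i /=.
rewrite -mulrA ler_pdivlMl ?exprn_gt0 // [_ * `|_|]mulrC [M * _]mulrC.
apply: le_trans (stepB i k.+1).
exact: (wsum_coef (iter i step u) (ord_max : 'I_k.+1) _ r0).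
Qed.

(** Since u = u_0 + ... + u_(n-1) t^(n-1) + X (step u), iterating step expands
    u in powers of X = t^n / w with coefficients that are polynomials in t of
    degree less than n.  The hypothesis on ev says that ev c is c(X). *)
Lemma division_by_powers (ev : T -> T) (u : T) :
    X * w = t ^+ n -> X 0%N = 0 ->
    (forall c, ev c = const1 (c 0%N) + X * ev (tshift c)) ->
  exists c : nat -> T, u = \sum_(k < n) ev (c k) * t ^+ k.
Proof.
move=> Xw X0 evE; pose c u k : T := Cps1 (step_convergent u k).
exists (c u); pose rem u := u - \sum_(k < n) ev (c u k) * t ^+ k.
have remE v : rem v = X * rem (step v).
  rewrite /rem {1}(tshift_truncation n v) -Xw.
  rewrite mulrBr mulrA; suff -> : \sum_(k < n) ev (c v k) * t ^+ k =
     \sum_(k < n) const1 (v k) * t ^+ k +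
     X * \sum_(k < n) ev (c (step v) k) * t ^+ k by rewrite /step; ring.
  rewrite mulr_sumr -big_split; apply: eq_bigr => k _.
  rewrite evE mulrDl -mulrA; congr (_ + _ * (ev _ * _)).
  apply: cps1P => i.
  by change ((iter i.+1 step v) k = (iter i step (step v)) k); rewrite iterSr.
suff : rem u = 0 by move=> /eqP; rewrite subr_eq0 => /eqP.
apply: tvar_adic => N; elim: N u => [|N IH] v; first by exists (rem v); rewrite mul1r.
have [b eb] := IH (step v).
exists (tshift X * b).
rewrite remE eb {1}(tshiftE X) X0 const1_0 add0r exprS; ring.
Qed.
End Division.

Lemma division_by_series (X : T) (ev : T -> T) :
    X != 0 -> X 0%N = 0 ->
    (forall c, ev c = const1 (c 0%N) + X * ev (tshift c)) ->
  exists n, forall u, exists c : nat -> T, u = \sum_(k < n) ev (c k) * t ^+ k.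
Proof.
move=> Xn0 X0 evE; have [v v0 eX] := ord_factor Xn0.
have [w wv] := cps1_unit v0; exists (ord X) => u.
apply: (@division_by_powers X w) => //.
by rewrite {1}eX -mulrA [v * w]mulrC wv mulr1.
Qed.
End Preparation.

(** * Branches of a plane curve *)

Section Branches.
Variable R : realType.
Local Notation C := (R[i]).
Local Notation T := (cps1 R).
Local Notation S := (cps2 R).
Local Notation t := (tvar R).
Local Notation x := (coord_x R).
Local Notation y := (coord_y R).
Variables (p : nat) (f : S) (fs : 'I_p -> S) (phi : 'I_p -> {rmorphism S -> T}).
Implicit Types (j : 'I_p) (h : S).
Hypothesis D_curve : reduced_curve f fs.
Hypothesis D_norm : normalization phi f fs.

(** phi j is a local homomorphism: otherwise some h - c with h(0) <> c, which
    is a unit, would have a nonunit as image. *)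
Lemma branch_coef0 j h : (phi j h) 0%N = h 0%N 0%N.
Proof.
apply/eqP; rewrite -subr_eq0; apply/negP => /negP ne.
pose g := h - const2 ((phi j h) 0%N).
have /cps2_unit /(rmorph_unit (phi j)) /unitrP[b [e _]] : g 0%N 0%N != 0.
  by rewrite cps2_BE -oppr_eq0 opprB.
have : (b * phi j g) 0%N = (1 : T) 0%N by rewrite e.
rewrite cps1_M fpsM0E rmorphB (norm_const D_norm) cps1_D cps1_N fpsBE subrr.
by rewrite mulr0 cps1_1 => /eqP; rewrite eq_sym oner_eq0.
Qed.

Lemma branch_nilpotent j h : h 0%N 0%N = 0 -> exists b, phi j h = t * b.
Proof.
move=> h0; exists (tshift (phi j h)).
by rewrite {1}(tshiftE (phi j h)) branch_coef0 h0 const1_0 add0r.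
Qed.

Lemma x_coef0 : x 0%N 0%N = 0. Proof. by []. Qed.
Lemma y_coef0 : y 0%N 0%N = 0. Proof. by []. Qed.

(** The chain rule.  The defect is a derivation along phi j that kills the
    constants and the coordinates, hence is divisible by all powers of t. *)
Lemma branch_chain_rule j h :
  tder (phi j h) = phi j (pdx h) * tder (phi j x) + phi j (pdy h) * tder (phi j y).
Proof.
pose d h := tder (phi j h) -
  (phi j (pdx h) * tder (phi j x) + phi j (pdy h) * tder (phi j y)).
have tP := tder_derivation R; have xP := pdx_derivation R; have yP := pdy_derivation R.
have dD a b : d (a + b) = d a + d b.
  by rewrite /d !(xP.1, yP.1, rmorphD, tP.1); ring.
have dM a b : d (a * b) = d a * phi j b + phi j a * d b.
  rewrite /d xP.2 yP.2 !rmorphM tP.2 !rmorphD !rmorphM; ring.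
have dx : d x = 0 by rewrite /d pdx_x pdy_x rmorph1 rmorph0; ring.
have dy : d y = 0 by rewrite /d pdx_y pdy_y rmorph1 rmorph0; ring.
have dc k : d (const2 k) = 0.
  by rewrite /d pdx_const pdy_const (norm_const D_norm) tder_const rmorph0; ring.
apply/eqP; rewrite -subr_eq0 -/(d h); apply/eqP.
have [X eX] := branch_nilpotent j x_coef0.
have [Y eY] := branch_nilpotent j y_coef0.
apply: tvar_adic => N; elim: N h => [|N IH] h.
  by exists (d h); rewrite mul1r.
have [h1 [h2 ->]] := cps2_decomp h.
have [b1 e1] := IH h1; have [b2 e2] := IH h2.
exists (X * b1 + Y * b2).
rewrite !dD !dM dx dy dc e1 e2 eX eY exprS; ring.
Qed.

Lemma nzd_branch j b : nzd_mod f b -> phi j b != 0.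
Proof.
move=> /(norm_unit D_norm)[q e]; apply/eqP => b0.
have := congr1 (fun g : total_frac R p => g j) e.
by rewrite !ffunE b0 tofrac0 mulr0 => /eqP; rewrite eq_sym oner_eq0.
Qed.

(** Otherwise phi j would be the evaluation at the origin, and t would not be
    a fraction of elements of its image. *)
Lemma branch_nonconstant j : phi j x = 0 -> phi j y = 0 -> False.
Proof.
move=> x0 y0.
have cE h : phi j h = const1 (h 0%N 0%N).
  have [h1 [h2 {1}->]] := cps2_decomp h.
  by rewrite !rmorphD !rmorphM x0 y0 !mul0r !addr0 (norm_const D_norm).
pose q : total_frac R p := [ffun=> t%:F].
have [a [b [bn e]]] := norm_frac D_norm q.
have := congr1 (fun g : total_frac R p => g j) e; rewrite !ffunE.
rewrite -tofracM => /eqP; rewrite tofrac_eq !cE => /eqP e'.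
have : (t * const1 (b 0%N 0%N)) 1%N = (const1 (a 0%N 0%N)) 1%N by rewrite e'.
rewrite tvarMS /= => b0.
have := nzd_branch j bn; rewrite cE b0.
by rewrite const1_0 eqxx.
Qed.

Lemma component_divides j : exists g, f = fs j * g.
Proof.
have [_ _ _ [u _ ->]] := D_curve.
exists (u * \prod_(i < p | i != j) fs i).
by rewrite (bigD1 j) //=; ring.
Qed.

Lemma branch_f j : phi j f = 0.
Proof.
apply/(norm_comp D_norm); have [g ->] := component_divides j.
by exists g; rewrite mulrC.
Qed.

Lemma component_coef0 j : fs j 0%N 0%N = 0.
Proof.
have [_ _ /(_ j)[_ nu _] _] := D_curve.
by apply/eqP; apply: contraNT nu; exact: cps2_unit.
Qed.

Section GenericLine.
Variable l : C.
Hypothesis f_line : line l f != 0.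

Lemma component_line j : line l (fs j) != 0.
Proof.
have [g e] := component_divides j; apply: contraNneq f_line => e0.
by rewrite e lineM e0 mul0r.
Qed.

(** A component that divides zcoord is the line itself, since zcoord has a
    nonzero linear part; but f does not vanish on the line. *)
Lemma branch_z j : phi j (zcoord l) != 0.
Proof.
apply/eqP => /(norm_comp D_norm)[c e].
have : line l c * line l (fs j) = 0 by rewrite -lineM -e line_z.
move/eqP; rewrite mulf_eq0 (negPf (component_line j)) orbF => /eqP c0.
have c00 : c 0%N 0%N = 0 by rewrite -(line_coef0 l) c0 cps1_0.
have : (pdx (zcoord l)) 0%N 0%N = 0.
  rewrite e (pdx_derivation R).2 cps2_DE !cps2_coef0M c00 component_coef0.
  by rewrite mulr0 mul0r addr0.
by rewrite pdx_z cps2_1 /= => /eqP; rewrite oner_eq0.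
Qed.

(** A reduced curve is generically smooth: otherwise fs j would divide its
    derivative along the line, which has smaller order. *)
Lemma branch_gradient j : phi j (pdx f) = 0 -> phi j (pdy f) = 0 -> False.
Proof.
set a := fs j; move=> fx0 fy0; have [g ef] := component_divides j.
have [_ red /(_ j)[a0 nu _] _] := D_curve; rewrite -/a in a0 nu ef.
have al := component_line j; rewrite -/a in al.
have f0 : f != 0.
  by apply: contraNneq f_line => ->; rewrite (rmorph0 (line l)).
have g0 : phi j g != 0.
  apply/eqP => /(norm_comp D_norm)[g' eg]; rewrite -/a in eg.
  have fE : f = a * g' * a by rewrite ef eg; ring.
  have h0 : a * g' != 0 by apply: contraNneq f0 => e; rewrite fE e mul0r.
  (* if f = a^2 g', then f divides the square of a g' but not a g' *)
  have [|c ec] := red (a * g') 2%N; first by exists g'; rewrite ef eg; ring.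
  have e : c * a = 1.
    by apply: (mulIf h0); rewrite mul1r {2}ec ef eg; ring.
  by move/negP: nu; apply; apply/unitrP; exists c; rewrite e mulrC e.
have xP := pdx_derivation R; have yP := pdy_derivation R.
have pa : phi j a = 0 by apply/(norm_comp D_norm); exists 1; rewrite mul1r.
have : phi j (pdx a) = 0.
  move: fx0; rewrite ef xP.2 rmorphD !rmorphM pa mul0r addr0 => /eqP.
  by rewrite mulf_eq0 (negPf g0) orbF => /eqP.
have : phi j (pdy a) = 0.
  move: fy0; rewrite ef yP.2 rmorphD !rmorphM pa mul0r addr0 => /eqP.
  by rewrite mulf_eq0 (negPf g0) orbF => /eqP.
move=> /(norm_comp D_norm)[m2 ey] /(norm_comp D_norm)[m1 ex].
have dl : tder (line l a) = line l (const2 l * m1 + m2) * line l a.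
  by rewrite line_derE -lineM /line_der ex ey -/a; congr line; ring.
have [v v0 ea] := ord_factor al; case: (ord _) ea => [|n] ea.
  have := component_coef0 j; rewrite -/a -(line_coef0 l) ea mul1r => e.
  by rewrite e eqxx in v0.
have : (tder (line l a)) n = 0.
  by rewrite dl ea mulrC -mulrA tvarXM ltnSn.
have -> : tder (line l a) n = line l a n.+1 *+ n.+1 by [].
rewrite ea tvarXM ltnn subnn => /eqP; rewrite mulrn_eq0 /= => /eqP e.
by rewrite e eqxx in v0.
Qed.

End GenericLine.
End Branches.

(** * The conductor and divisibility on the curve *)

Section Duality.
Variable R : realType.
Local Notation C := (R[i]).
Local Notation T := (cps1 R).
Local Notation QT := {fraction T}.
Local Notation S := (cps2 R).
Local Notation t := (tvar R).
Local Notation tF := (t%:F : QT).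
Local Notation x := (coord_x R).
Local Notation y := (coord_y R).
Variables (p : nat) (f : S) (fs : 'I_p -> S) (phi : 'I_p -> {rmorphism S -> T}).
Implicit Types (i j : 'I_p) (a b h : S) (q g : total_frac R p).
Hypothesis D_curve : reduced_curve f fs.
Hypothesis D_norm : normalization phi f fs.

Lemma common_denominator j n : exists b, phi j b != 0 /\
  forall k, (k < n)%N ->
  exists a, forall i, phi i a = if i == j then t ^+ k * phi j b else 0.
Proof.
elim: n => [|n [b [b0 IH]]].
  by exists 1; split=> //; rewrite rmorph1 oner_eq0.
pose q : total_frac R p := [ffun i => if i == j then (t ^+ n)%:F else 0].
have [a' [b' [bn e]]] := norm_frac D_norm q.
have e' i : phi i a' = if i == j then t ^+ n * phi j b' else 0.
  have := congr1 (fun g : total_frac R p => g i) e; rewrite !ffunE.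
  case: eqP => [->|_] /eqP.
    by rewrite -tofracM tofrac_eq => /eqP ->.
  by rewrite mul0r eq_sym tofrac_eq0 => /eqP.
exists (b * b'); split.
  by rewrite rmorphM mulf_eq0 negb_or b0; exact: (nzd_branch D_norm j bn).
move=> k; rewrite ltnS leq_eqVlt => /orP[/eqP ->|/IH[a ea]].
  exists (a' * b) => i; rewrite rmorphM e'; case: eqP => [->|]; last by rewrite mul0r.
  by rewrite rmorphM; ring.
exists (a * b') => i; rewrite rmorphM ea; case: eqP => [->|]; last by rewrite mul0r.
by rewrite rmorphM; ring.
Qed.

(** C{t_j} is generated by 1, ..., t^(n-1) over the series c(z) = inj c; as
    elements of Q(O_D) supported on D_j these generators have a common
    denominator b. *)
Lemma branch_conductor_sub j (z : S) (inj : T -> S) :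
    z 0%N 0%N = 0 -> phi j z != 0 ->
    (forall c, inj c = const2 (c 0%N) + z * inj (tshift c)) ->
  exists N, forall u : T,
  exists h, forall i, phi i h = if i == j then t ^+ N * u else 0.
Proof.
move=> z00 z0 injE.
have zc0 : (phi j z) 0%N = 0 by rewrite (branch_coef0 D_norm).
have evE c : phi j (inj c) = const1 (c 0%N) + phi j z * phi j (inj (tshift c)).
  by rewrite injE rmorphD rmorphM (norm_const D_norm).
have [n div] := @division_by_series _ _ (fun c => phi j (inj c)) z0 zc0 evE.
have [b [b0 hb]] := common_denominator j n.
have /choice[a ea] := fun k : 'I_n => hb k (ltn_ord k).
have [v v0 eb] := ord_factor b0; have [w wv] := cps1_unit v0.
exists (ord (phi j b)) => u; have [c ec] := div (w * (v * (w * u))).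
exists (\sum_(k < n) a k * inj (c k)) => i; rewrite rmorph_sum.
under eq_bigr => k _ do rewrite rmorphM ea.
case: eqP => [->|_]; last by rewrite big1 // => k _; rewrite mul0r.
transitivity (phi j b * (w * (v * (w * u)))).
  by rewrite ec mulr_sumr; apply: eq_bigr => k _; ring.
rewrite {1}eb.
have -> : t ^+ ord (phi j b) * v * (w * (v * (w * u))) =
  t ^+ ord (phi j b) * ((w * v) * ((w * v) * u)) by ring.
by rewrite wv !mul1r.
Qed.

Lemma branch_conductor j : exists N, forall u : T,
  exists h, forall i, phi i h = if i == j then t ^+ N * u else 0.
Proof.
have [x0|x0] := eqVneq (phi j x) 0; last first.
  by apply: (branch_conductor_sub (x_coef0 R) x0) => c; exact: in_x_shift.
have y0 : phi j y != 0 by apply/eqP => y0; exact: (branch_nonconstant D_norm x0 y0).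
by apply: (branch_conductor_sub (y_coef0 R) y0) => c; exact: in_y_shift.
Qed.

Lemma conductor_exists : exists N, forall u : 'I_p -> T,
  exists h, forall i, phi i h = t ^+ N * u i.
Proof.
have /choice[N hN] := branch_conductor.
exists (\sum_i N i)%N => u.
have /choice[h eh] := fun j => hN j (t ^+ (\sum_i N i - N j) * u j).
exists (\sum_j h j) => i; rewrite rmorph_sum (bigD1 i) //= big1.
  rewrite addr0 eh eqxx mulrA -exprD subnKC // (bigD1 i) //=.
  exact: leq_addr.
by move=> j ji; rewrite eh eq_sym (negPf ji).
Qed.

Section GenericLine.
Variable l : C.
Hypothesis f_line : line l f != 0.
Local Notation z := (zcoord l).
Local Notation lam := (line_res f_line).

Lemma z_coef0 : z 0%N 0%N = 0.
Proof.
by rewrite cps2_BE cps2_coef0M x_coef0 y_coef0 mulr0 subrr.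
Qed.

Lemma div_z N h : exists h' (g : nat -> C) (r : S),
  h = z * h' + \sum_(i < N) const2 (g i) * y ^+ i + y ^+ N * r.
Proof.
elim: N h => [|N IH] h.
  by exists 0, (fun _ => 0), h; rewrite mulr0 big_ord0 mul1r !add0r.
have [h1 [h2 eh]] := cps2_decomp h.
have [h' [g [r e]]] := IH (h2 + const2 l * h1).
exists (h1 + y * h'), (fun i : nat => if i is i'.+1 then g i' else h 0%N 0%N), r.
rewrite big_ord_recl expr0 mulr1 exprS.
transitivity (const2 (h 0%N 0%N) + z * h1 + y * (h2 + const2 l * h1)).
  by rewrite {1}eh /zcoord; ring.
rewrite e !mulrDr mulr_sumr.
under [in RHS]eq_bigr => i _ do rewrite lift0 exprS mulrCA.
ring.
Qed.

Lemma z_nilpotent : exists Z : 'I_p -> T, forall j, phi j z = t * Z j.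
Proof.
by have /choice[Z eZ] := fun j => branch_nilpotent D_norm j z_coef0; exists Z.
Qed.

Lemma y_power_in_z : exists M, forall r : S, exists h,
  forall j, phi j (y ^+ M * r) = phi j (z * h).
Proof.
(* ov j consists of the order o and the unit v in phi j z = t^o v, and of the
   inverse of v *)
have [N hN] := conductor_exists.
have Zf j : exists (ov : nat * T * T), ov.2 * ov.1.2 = 1 /\ phi j z = t ^+ ov.1.1 * ov.1.2.
  have [v v0 e] := ord_factor (branch_z D_curve D_norm f_line j).
  by have [w wv] := cps1_unit v0; exists (ord (phi j z), v, w).
have /choice[ov eov] := Zf.
have /choice[Y eY] := fun j => branch_nilpotent D_norm j (y_coef0 R).
pose O := (\sum_j (ov j).1.1)%N; exists (N + O)%N => r.
have [h eh] := hN (fun j => t ^+ (O - (ov j).1.1) * (ov j).2 * Y j ^+ (N + O) * phi j r).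
exists h => j; rewrite !rmorphM rmorphXn eh eY.
have [e1 ->] := eov j; set o := (ov j).1.1; set v := (ov j).1.2 in e1 *; set w := (ov j).2 in e1 *.
have oO : (o <= O)%N by rewrite /O (bigD1 j) //= leq_addr.
have eN : t ^+ (N + O) = t ^+ N * (t ^+ o * t ^+ (O - o)) by rewrite -!exprD subnKC.
rewrite exprMn eN -[LHS]mulr1 -e1; ring.
Qed.

(** If a is orthogonal to everything modulo zcoord, then a is divisible by
    zcoord on D: subtracting a multiple of f makes a vanish to high order on
    the line, and the conductor absorbs the remainder. *)
Lemma orthogonal_divisible a : (forall h, lam (a * h) 0%N = 0) ->
  exists a', forall j, phi j a = phi j (z * a').
Proof.
move=> /line_res_nondegenerate[c ec].
have [M hM] := y_power_in_z.
pose cM := \sum_(i < M) const2 (c i) * y ^+ i.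
have line_poly (g : nat -> C) : line l (\sum_(i < M) const2 (g i) * y ^+ i) =
    \sum_(i < M) const1 (g i) * t ^+ i.
  rewrite (rmorph_sum (line l)); apply: eq_bigr => i _.
  by rewrite [LHS]lineM lineX line_y line_const.
have [h' [g [r e]]] := div_z M (a - f * cM).
have g0 (i : nat) : (i < M)%N -> g i = 0.
  move=> iM.
  have e1 : line l (a - f * cM) = t ^+ M * (line l f * iter M (@tshift R) c).
    rewrite [LHS](rmorphB (line l)) [X in _ - X]lineM.
    change (line l a - line l f * line l cM = t ^+ M * (line l f * iter M (@tshift R) c)).
    by rewrite ec {1}(tshift_truncation M c) line_poly; ring.
  have e2 : line l (a - f * cM) = \sum_(i < M) const1 (g i) * t ^+ i + t ^+ M * line l r.
    rewrite e (rmorphD (line l)) (rmorphD (line l)).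
    change (line l (z * h') + line l (\sum_(i < M) const2 (g i) * y ^+ i) +
      line l (y ^+ M * r) = \sum_(i < M) const1 (g i) * t ^+ i + t ^+ M * line l r).
    by rewrite line_poly !lineM lineX line_y line_z mul0r add0r.
  have : (\sum_(i < M) const1 (g i) * t ^+ i) i = 0.
    have -> : \sum_(i < M) const1 (g i) * t ^+ i =
       t ^+ M * (line l f * iter M (@tshift R) c - line l r).
      by rewrite mulrBr -e1 e2 addrK.
    by rewrite tvarXM iM.
  have cs (s : seq 'I_M) (F : 'I_M -> T) : (\sum_(k <- s) F k) i = \sum_(k <- s) F k i.
    by elim/big_rec2: _ => [|k u v _ <-]; rewrite ?cps1_0 ?fps0E // cps1_D.
  rewrite cs (bigD1 (Ordinal iM)) // big1; last first.
    move=> k /eqP ki; rewrite const1ME -[t ^+ k]mulr1 tvarXM.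
    case: ltnP => ki'; first by rewrite mulr0.
    rewrite cps1_1 fps1E subn_eq0; case: leqP => ik; last by rewrite mulr0.
    by case: ki; apply/val_inj/eqP; rewrite eqn_leq ki' ik.
  change ((const1 (g i) * t ^+ i) i + 0 = 0 -> g i = 0).
  by rewrite addr0 const1ME -[t ^+ i]mulr1 tvarXM ltnn subnn cps1_1 mulr1.
have [h eh] := hM r; exists (h' + h) => j.
have -> : phi j a = phi j (a - f * cM).
  by rewrite rmorphB rmorphM (branch_f D_curve D_norm) mul0r subr0.
rewrite e big1 ?addr0; last first.
  move=> i _; rewrite g0 //; have -> : const2 (0 : C) = 0 :> S.
    by apply: cps2P => i1 i2; rewrite cps2_0E; case: i1 => [|i1] //; case: i2.
  by rewrite mul0r.
by rewrite rmorphD eh mulrDr rmorphD.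
Qed.

(** A power of zcoord cancels the poles of q and another one brings the
    product into the conductor. *)
Lemma z_denominator q : exists kh : nat * S,
  forall j, q j * (phi j z)%:F ^+ kh.1.+1 = (phi j kh.2)%:F.
Proof.
have [N hN] := conductor_exists; have [Z eZ] := z_nilpotent.
have /choice[ma ema] : forall j, exists ma : nat * T, q j * tF ^+ ma.1.+1 = ma.2%:F.
  by move=> j; have [m [a e]] := frac_denominator (q j); exists (m, a).
pose M := (\sum_j (ma j).1)%N.
have [h eh] := hN (fun j => (ma j).2 * t ^+ (M - (ma j).1) * Z j ^+ (N + M).+1).
exists (N + M, h)%N => j; rewrite /= eh eZ !tofracM !tofracXn -ema.
set m := (ma j).1; have mM : (m <= M)%N by rewrite /M (bigD1 j) //= leq_addr.
have eT : tF ^+ (N + M).+1 = tF ^+ N * tF ^+ m.+1 * tF ^+ (M - m).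
  by rewrite -!exprD -addnA addSn subnKC // addnS.
by rewrite exprMn eT; ring.
Qed.

End GenericLine.
End Duality.

(** * The residue pairing of the curve *)

Section ResiduePairing.
Variable R : realType.
Local Notation C := (R[i]).
Local Notation T := (cps1 R).
Local Notation QT := {fraction T}.
Local Notation S := (cps2 R).
Local Notation D := (qder (@tder R)).
Local Notation t := (tvar R).
Local Notation tF := (t%:F : QT).
Local Notation x := (coord_x R).
Local Notation y := (coord_y R).
Variables (p : nat) (f : S) (fs : 'I_p -> S) (phi : 'I_p -> {rmorphism S -> T}).
Implicit Types (i j : 'I_p) (a b h : S) (q g : total_frac R p).
Hypothesis D_curve : reduced_curve f fs.
Hypothesis D_norm : normalization phi f fs.
Variable l : C.
Hypothesis f_line : line l f != 0.
Local Notation z := (zcoord l).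
Local Notation E := (line_der l).
Local Notation lam := (line_res f_line).

Definition z_fraction q k h :=
  forall j, q j * (phi j z)%:F ^+ k.+1 = (phi j h)%:F.

(** The residue of q dx dy / f.  If q z^(k+1) = h on D, then it is the residue
    at z = 0 of (line_res h) dz / z^(k+1). *)
Definition curve_residue q : C :=
  let kh := projT1 (cid (z_denominator D_norm l q)) in
  lam kh.2 kh.1.

Let zF_neq0 j : (phi j z)%:F != 0 :> QT.
Proof. by rewrite tofrac_eq0; exact: (branch_z D_curve D_norm f_line). Qed.

Lemma line_res_zX n h : lam (z ^+ n * h) = fpsX C ^+ n * lam h.
Proof.
elim: n => [|n IH]; first by rewrite !mul1r.
by rewrite !exprS -!mulrA line_res_z IH.
Qed.

Lemma line_res_pullback a b : (forall j, phi j a = phi j b) -> lam a = lam b.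
Proof.
move=> ab; have [g eg] : divides f (a - b).
  apply/(norm_ker D_norm)/ffunP => j; rewrite !ffunE.
  by rewrite rmorphB ab subrr tofrac0.
by rewrite -[a](subrK b) eg mulrC line_resD line_res_f add0r.
Qed.

Lemma curve_residue_unfold q k h : z_fraction q k h -> curve_residue q = lam h k.
Proof.
rewrite /curve_residue; case: cid => -[k' h'] /= e' e.
have : lam (z ^+ k.+1 * h') = lam (z ^+ k'.+1 * h).
  apply: line_res_pullback => j; rewrite !rmorphM !rmorphXn; apply/eqP.
  rewrite -tofrac_eq !tofracM !tofracXn -e -e'; apply/eqP.
  by rewrite mulrCA [RHS]mulrCA; congr (_ * _); rewrite mulrC.
rewrite !line_res_zX => /(congr1 (fun c : fps C => c (k + k').+1)).
rewrite !fpsXnM.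
have -> : ((k + k').+1 < k.+1)%N = false by lia.
have -> : ((k + k').+1 < k'.+1)%N = false by lia.
by rewrite !subSS addKn addnK.
Qed.

Lemma z_fraction_raise q k h n :
  z_fraction q k h -> z_fraction q (k + n) (h * z ^+ n).
Proof.
move=> e j; rewrite rmorphM rmorphXn tofracM tofracXn -e -mulrA -exprD.
by rewrite addSn.
Qed.

Lemma z_fraction_ex q : exists k h, z_fraction q k h.
Proof. by have [[k h] e] := z_denominator D_norm l q; exists k, h. Qed.

Lemma curve_residueD q g : curve_residue (q + g) = curve_residue q + curve_residue g.
Proof.
have [k [h e]] := z_fraction_ex q; have [k' [h' e']] := z_fraction_ex g.
have ek := z_fraction_raise k' e; have ek' := z_fraction_raise k e'.
rewrite addnC in ek'; rewrite (curve_residue_unfold ek) (curve_residue_unfold ek').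
rewrite -fpsDE -line_resD; apply: curve_residue_unfold => j.
by rewrite ffunE mulrDl ek ek' -tofracD (rmorphD (phi j)).
Qed.

Lemma curve_residue_pullback q h : (forall j, q j = (phi j h)%:F) -> curve_residue q = 0.
Proof.
move=> e; rewrite (@curve_residue_unfold _ 0%N (z * h)); first by rewrite line_res_z fpsXM0.
by move=> j; rewrite e expr1 rmorphM tofracM mulrC.
Qed.

Lemma curve_residue_scale (c : C) q : curve_residue [ffun j => (const1 c)%:F * q j] = c * curve_residue q.
Proof.
have [k [h e]] := z_fraction_ex q; rewrite (curve_residue_unfold e).
rewrite -(line_res_const f_line); apply: curve_residue_unfold => j.
by rewrite ffunE -mulrA e rmorphM (norm_const D_norm) tofracM.
Qed.

(** If q z^(k+1) is in O_D, then pairing q with z^k O_D shows that q z^(k+1)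
    is orthogonal to everything modulo z, hence that q z^k is in O_D. *)
Lemma curve_residue_orthogonal q : (forall h, curve_residue [ffun j => q j * (phi j h)%:F] = 0) ->
  exists a, forall j, q j = (phi j a)%:F.
Proof.
move=> H; have [k [h e]] := z_fraction_ex q.
have {e} : forall j, q j * (phi j z)%:F ^+ k.+1 = (phi j h)%:F by [].
elim: k.+1 h => [|n IH] h e; first by exists h => j; rewrite -e mulr1.
have [|a ea] := @orthogonal_divisible _ _ _ _ _ D_curve D_norm _ f_line h.
  move=> b; have := H (z ^+ n * b); rewrite (@curve_residue_unfold _ 0%N (h * b)) // => j.
  rewrite ffunE !(rmorphM (phi j)) (rmorphXn (phi j)) !tofracM !tofracXn -e expr1 exprS.
  ring.
apply: (IH a) => j; apply: (mulIf (zF_neq0 j)).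
by rewrite -mulrA -exprSr e ea rmorphM tofracM mulrC.
Qed.

Lemma curve_residue_sum (I : Type) (r : seq I) (F : I -> total_frac R p) :
  curve_residue (\sum_(i <- r) F i) = \sum_(i <- r) curve_residue (F i).
Proof.
elim: r => [|i r IH]; last by rewrite !big_cons curve_residueD IH.
rewrite !big_nil (@curve_residue_pullback _ 0) // => j.
by rewrite ffunE rmorph0 tofrac0.
Qed.

(** The gradient of f along D_j is normal to the velocity, and s j is the
    factor of proportionality; so dt / s j is dx / f_y restricted to D_j. *)
Definition is_slope (s : 'I_p -> QT) : Prop := forall j,
  [/\ s j != 0, (phi j (pdy f))%:F = s j * (tder (phi j x))%:F
    & (phi j (pdx f))%:F = - s j * (tder (phi j y))%:F].

(** The chain rule for f = 0 makes the gradient normal to the curve, and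
    neither the gradient nor the velocity vanishes identically on a branch. *)
Lemma slope_exists : exists s, is_slope s.
Proof.
suff H j : exists s : QT, [/\ s != 0, (phi j (pdy f))%:F = s * (tder (phi j x))%:F
    & (phi j (pdx f))%:F = - s * (tder (phi j y))%:F].
  by have /choice[s hs] := H; exists s.
have ch := branch_chain_rule D_norm j f.
rewrite (branch_f D_curve D_norm) (der0 (tder_derivation R)) in ch.
have grad := @branch_gradient _ _ _ _ _ D_curve D_norm _ f_line j.
set fx := phi j (pdx f) in ch grad *; set fy := phi j (pdy f) in ch grad *.
set x' := tder (phi j x) in ch *; set y' := tder (phi j y) in ch *.
have chF : fx%:F * x'%:F = - (fy%:F * y'%:F) :> QT.
  by apply/eqP; rewrite -addr_eq0 -!tofracM -tofracD -ch tofrac0.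
have nz (c : T) : tder c = 0 -> c 0%N = 0 -> c = 0.
  move=> dc c0; apply: cps1P => -[|n]; first by rewrite cps1_0 fps0E.
  have : c n.+1 *+ n.+1 = (0 : T) n by rewrite -dc.
  by rewrite !cps1_0 !fps0E => /eqP; rewrite mulrn_eq0 /= => /eqP.
have [x0|x0] := eqVneq x' 0; last first.
  have xF : x'%:F != 0 :> QT by rewrite tofrac_eq0.
  exists (fy%:F / x'%:F); split.
  - apply/eqP => s0; apply: grad.
      apply/eqP; rewrite -tofrac_eq0; apply/eqP; apply: (mulIf xF).
      rewrite chF mul0r; have -> : fy%:F = 0 :> QT.
        by rewrite -[fy%:F](divfK xF) s0 mul0r.
      by rewrite mul0r oppr0.
    apply/eqP; rewrite -tofrac_eq0; apply/eqP.
    by rewrite -[fy%:F](divfK xF) s0 mul0r.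
  - by rewrite (divfK xF).
  apply: (mulIf xF); rewrite chF mulNr mulNr; congr (- _).
  by rewrite mulrAC (divfK xF).
have [y0|y0] := eqVneq y' 0.
  case: (@branch_nonconstant _ _ _ _ _ D_norm j).
    by apply: nz x0 _; rewrite (branch_coef0 D_norm).
  by apply: nz y0 _; rewrite (branch_coef0 D_norm).
have yF : y'%:F != 0 :> QT by rewrite tofrac_eq0.
have fy0 : fy%:F = 0 :> QT.
  apply: (mulIf yF); apply: oppr_inj.
  by rewrite -chF x0 tofrac0 mulr0 mul0r oppr0.
exists (- (fx%:F / y'%:F)); split.
- rewrite oppr_eq0; apply/eqP => s0; apply: grad.
    apply/eqP; rewrite -tofrac_eq0; apply/eqP.
    by rewrite -[fx%:F](divfK yF) s0 mul0r.
  by apply/eqP; rewrite -tofrac_eq0 fy0.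
- by rewrite fy0 x0 tofrac0 mulr0.
by rewrite opprK (divfK yF).
Qed.

Variable s : 'I_p -> QT.
Hypothesis sP : is_slope s.

Lemma slope_der j b : s j * (tder (phi j b))%:F =
  (phi j (pdx b * pdy f - pdy b * pdx f))%:F.
Proof.
have [_ ey ex] := sP j.
rewrite (branch_chain_rule D_norm) (rmorphB (phi j)) !(rmorphM (phi j)) tofracD tofracB !tofracM.
by rewrite ex ey; ring.
Qed.

(** For q = b / z^(k+1) the function s q' is the bracket of b / z^(k+1) and f;
    the terms from the derivatives of b and of z^(k+1) cancel by
    line_res_bracket. *)
Lemma curve_residue_slope_der q : curve_residue [ffun j => s j * D (q j)] = 0.
Proof.
have [k [b e]] := z_fraction_ex q; have TP := tder_derivation R.
pose J := pdx b * pdy f - pdy b * pdx f.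
have DP := qder_derivation TP.
have Jz : pdx z * pdy f - pdy z * pdx f = E f.
  by rewrite pdx_z pdy_z /line_der; ring.
have zf : z_fraction [ffun j => s j * D (q j)] k.+1 (z * J - (b * E f) *+ k.+1).
  move=> j; have phiMn a n : phi j (a *+ n) = phi j a *+ n by exact: rmorphMn.
  rewrite ffunE (rmorphB (phi j) (z * J)) phiMn !(rmorphM (phi j)) -Jz -/J.
  rewrite tofracB tofracMn !tofracM -(slope_der j b) -(slope_der j z) -e.
  have <- : D (q j * (phi j z)%:F ^+ k.+1) = (tder (phi j b))%:F.
    by rewrite e qder_tofrac.
  rewrite DP.2 (derX DP) qder_tofrac // !exprS; ring.
rewrite (curve_residue_unfold zf) line_resB fpsBE line_res_z fpsXMS line_res_bracket.
suff -> : forall n a, lam (a *+ n) = lam a *+ n by rewrite fpsMnE subrr.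
move=> n a; elim: n => [|n IH]; last by rewrite !mulrS line_resD IH.
by rewrite !mulr0n -(line_res_f f_line 0) mulr0.
Qed.

(** A multiple of the residue at t = 0 of the differential c dt on D_j. *)
Definition branch_residue j (c : QT) : C :=
  curve_residue [ffun i => if i == j then s i * c else 0].

Lemma branch_residueD j c d : branch_residue j (c + d) = branch_residue j c + branch_residue j d.
Proof.
rewrite -curve_residueD; congr curve_residue; apply/ffunP => i; rewrite !ffunE.
by case: eqP => _; rewrite ?addr0 // mulrDr.
Qed.

Lemma branch_residue_scale j (k : C) c : branch_residue j ((const1 k)%:F * c) = k * branch_residue j c.
Proof.
rewrite -curve_residue_scale; congr curve_residue; apply/ffunP => i; rewrite !ffunE.
by case: eqP => _; rewrite ?mulr0 // mulrCA.
Qed.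

Lemma branch_residue_der j c : branch_residue j (D c) = 0.
Proof.
rewrite -(curve_residue_slope_der [ffun i => if i == j then c else 0]).
congr curve_residue; apply/ffunP => i; rewrite !ffunE; case: eqP => _ //.
by rewrite (der0 (qder_derivation (tder_derivation R))) mulr0.
Qed.

Lemma branch_residue_tofrac j (u : T) : branch_residue j u%:F = 0.
Proof.
by have [g ->] := frac_primitive (res_tofrac u); exact: branch_residue_der.
Qed.

Lemma curve_residue_slope_sum (c : 'I_p -> QT) :
  curve_residue [ffun j => s j * c j] = \sum_j branch_residue j (c j).
Proof.
rewrite -curve_residue_sum; congr curve_residue; apply/ffunP => i; rewrite ffunE sum_ffunE.
rewrite (bigD1 i) //= ffunE eqxx big1 ?addr0 // => j ji.
by rewrite ffunE eq_sym (negPf ji).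
Qed.

(** Regular functions have primitives, so s u h has residue 0 for every h in
    O_D, and s u is orthogonal to O_D. *)
Lemma slope_in_OD (u : 'I_p -> T) :
  exists a, forall j, s j * (u j)%:F = (phi j a)%:F.
Proof.
have [|a ea] := @curve_residue_orthogonal [ffun j => s j * (u j)%:F].
  move=> h.
  have -> : [ffun j => [ffun j => s j * (u j)%:F] j * (phi j h)%:F] =
            [ffun j => s j * (u j * phi j h)%:F] :> total_frac R p.
    by apply/ffunP => j; rewrite !ffunE tofracM mulrA.
  by rewrite curve_residue_slope_sum big1 // => j _; exact: branch_residue_tofrac.
by exists a => j; rewrite -ea ffunE.
Qed.

(** Otherwise Q(C{t_j}) would be orthogonal to O_D, hence contained in it. *)
Lemma branch_residue_simple_pole j : branch_residue j tF^-1 != 0.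
Proof.
apply/eqP => n0.
have nu0 c : branch_residue j c = 0.
  have [g ->] := frac_residue_split c.
  by rewrite branch_residueD branch_residue_scale n0 mulr0 branch_residue_der addr0.
have [|a ea] := @curve_residue_orthogonal [ffun i => if i == j then tF^-1 else 0].
  move=> h; rewrite -(nu0 ((s j)^-1 * (tF^-1 * (phi j h)%:F))).
  congr curve_residue; apply/ffunP => i; rewrite !ffunE; case: eqP => [->|_]; last by rewrite mul0r.
  by have [s0 _ _] := sP j; rewrite (mulVKf s0).
have := ea j; rewrite ffunE eqxx => e.
have : t * phi j a = 1.
  apply/eqP; rewrite -tofrac_eq tofracM -e tofrac1 mulfV //; exact: tF_neq0.
move=> e1; have : (t * phi j a) 0%N = (1 : T) 0%N by rewrite e1.
by rewrite tvarM0 cps1_1 => /eqP; rewrite eq_sym oner_eq0.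
Qed.

End ResiduePairing.

(** * Logarithmic residues and their values *)

Section LogarithmicResidues.
Variable R : realType.
Local Notation T := (cps1 R).
Local Notation QT := {fraction T}.
Local Notation S := (cps2 R).
Local Notation QS := {fraction S}.
Local Notation t := (tvar R).
Local Notation tF := (t%:F : QT).
Local Notation x := (coord_x R).
Local Notation y := (coord_y R).
Variables (p : nat) (f : S) (fs : 'I_p -> S) (phi : 'I_p -> {rmorphism S -> T}).
Implicit Types (i j : 'I_p) (a b h : S) (q r : total_frac R p).
Hypothesis D_curve : reduced_curve f fs.
Hypothesis D_norm : normalization phi f fs.

Lemma curve_neq0 : f != 0.
Proof.
have [_ _ irr [u u1 ->]] := D_curve.
apply: mulf_neq0; first by apply: contraTneq u1 => ->; rewrite unitr0.
by apply/prodf_neq0 => i _; have [] := irr i.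
Qed.

Let fF_neq0 : f%:F != 0 :> QS.
Proof. by rewrite tofrac_eq0; exact: curve_neq0. Qed.

(** The logarithmic residues are the inverse of the Jacobian ideal: a form
    (a dx + b dy)/f is logarithmic exactly when b f_x - a f_y lies in (f),
    and its residue is then the common value of a/f_x and b/f_y on D. *)
Lemma log_residuesP r : log_residues phi f r <->
  exists a b, forall j, r j * (phi j (pdx f))%:F = (phi j a)%:F /\
                        r j * (phi j (pdy f))%:F = (phi j b)%:F.
Proof.
split=> [[w [[a ea] [b eb] _] [g [xi [e1 [e2 [gn eq1 eq2 ->]]]]]]|].
  exists a, b => j; rewrite ffunE.
  have gF : (phi j g)%:F != 0 :> QT by rewrite tofrac_eq0; exact: (nzd_branch D_norm j gn).
  have key (c d e : S) (v : QS) : f%:F * v = c%:F ->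
      g%:F * v = xi%:F * (d%:F / f%:F) + e%:F ->
      (phi j xi)%:F / (phi j g)%:F * (phi j d)%:F = (phi j c)%:F.
    move=> ev eg; have e3 : g * c = xi * d + e * f.
      apply/eqP; rewrite -tofrac_eq tofracD !tofracM -ev; apply/eqP.
      by rewrite mulrCA eg mulrDr mulrCA (mulrCA f%:F) (mulfV fF_neq0) mulr1 [f%:F * _]mulrC.
    apply: (mulIf gF); rewrite mulrAC (divfK gF) -!tofracM -!(rmorphM (phi j)).
    rewrite [c * g]mulrC e3 (rmorphD (phi j)) [phi j (e * f)]rmorphM.
    by rewrite (branch_f D_curve D_norm) mulr0 addr0.
  by split; [exact: key ea eq1|exact: key eb eq2].
move=> [a [b H]].
have in_f (c : S) : (forall j, phi j c = 0) -> exists d, c = d * f.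
  move=> c0; apply/(norm_ker D_norm)/ffunP => j.
  by rewrite !ffunE c0 tofrac0.
have [g eg] : exists g, b * pdx f - a * pdy f = g * f.
  apply: in_f => j; have [h1 h2] := H j.
  apply/eqP; rewrite -tofrac_eq0 (rmorphB (phi j)) !(rmorphM (phi j)) tofracB !tofracM.
  by rewrite -h1 -h2; apply/eqP; ring.
have [xi [d [dn ed]]] := norm_frac D_norm r.
have edj j : r j * (phi j d)%:F = (phi j xi)%:F.
  by have := congr1 (fun q : total_frac R p => q j) ed; rewrite !ffunE.
have res_eq (c e : S) : (forall j, r j * (phi j e)%:F = (phi j c)%:F) ->
    exists eta, d%:F * (c%:F / f%:F) = xi%:F * (e%:F / f%:F) + eta%:F :> QS.
  move=> ce; have [eta ee] : exists eta, d * c - xi * e = eta * f.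
    apply: in_f => j; apply/eqP; rewrite -tofrac_eq0 (rmorphB (phi j)) !(rmorphM (phi j)).
    by rewrite tofracB !tofracM -edj -ce; apply/eqP; ring.
  exists eta; apply: (mulIf fF_neq0); rewrite mulrDl -!mulrA (mulVf fF_neq0) !mulr1.
  by rewrite -!tofracM -tofracD -ee addrC subrK.
have [eta1 E1] := res_eq a (pdx f) (fun j => (H j).1).
have [eta2 E2] := res_eq b (pdy f) (fun j => (H j).2).
exists (a%:F / f%:F, b%:F / f%:F).
  split=> /=; first by exists a; rewrite mulrC (divfK fF_neq0).
    by exists b; rewrite mulrC (divfK fF_neq0).
  exists (pdx b - pdy a - g).
  change (f%:F * (qder (@pdx R) (b%:F / f%:F) - qder (@pdy R) (a%:F / f%:F)) =
    (pdx b - pdy a - g)%:F).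
  have f0 := curve_neq0.
  rewrite (qder_div (pdx_derivation R) b f0) (qder_div (pdy_derivation R) a f0).
  have ffF : (f ^+ 2)%:F != 0 :> QS by rewrite tofrac_eq0 expf_neq0.
  rewrite -mulrBl mulrA; apply: (mulIf ffF); rewrite (divfK ffF).
  rewrite -tofracB -!tofracM; congr (_%:F).
  transitivity (f * (f * (pdx b - pdy a) - (b * pdx f - a * pdy f))); first ring.
  by rewrite eg; ring.
exists d, xi, eta1, eta2; split=> //.
apply/ffunP => j; rewrite ffunE -edj mulfK // tofrac_eq0.
exact: (nzd_branch D_norm j dn).
Qed.

Lemma tder_order (c : T) : c != 0 -> c 0%N = 0 ->
  exists n (u : T), [/\ u 0%N != 0, tder c = t ^+ n * u & val_t c%:F = (n.+1)%:Z%:E].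
Proof.
move=> c0 cz; have [v v0] := ord_factor c0.
case: (ord c) => [|n] ec.
  by move: cz; rewrite ec mul1r => e; rewrite e eqxx in v0.
exists n, (v *+ n.+1 + t * tder v); split.
- by rewrite cps1_D fpsDE tvarM0 addr0 cps1_Mn fpsMnE mulrn_eq0.
- have dP := tder_derivation R.
  by rewrite ec dP.2 (derX dP) tder_tvar exprS; ring.
by rewrite ec tofracM tofracXn exprnP val_tE.
Qed.

Lemma multiplicityP j : exists m : nat, multiplicity phi j = (m.+1)%:Z /\
  exists a b : T, [/\ tder (phi j x) = t ^+ m * a, tder (phi j y) = t ^+ m * b
                  & (a 0%N != 0) || (b 0%N != 0)].
Proof.
have x0 : (phi j x) 0%N = 0 by rewrite (branch_coef0 D_norm).
have y0 : (phi j y) 0%N = 0 by rewrite (branch_coef0 D_norm).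
have dP := tder_derivation R.
rewrite /multiplicity; have [xn|xn] := eqVneq (phi j x) 0.
  have [yn|yn] := eqVneq (phi j y) 0.
    by case: (branch_nonconstant D_norm xn yn).
  have [n [u [u0 du vu]]] := tder_order yn y0; exists n; split.
    by rewrite xn tofrac0 /val_t eqxx -/(val_t _) vu.
  by exists 0, u; rewrite xn (der0 dP) mulr0 u0 orbT.
have [k [v [v0 dv vv]]] := tder_order xn x0.
have [yn|yn] := eqVneq (phi j y) 0.
  exists k; split; first by rewrite vv yn tofrac0 /val_t eqxx.
  by exists v, 0; rewrite yn (der0 dP) mulr0 v0.
have [n [u [u0 du vu]]] := tder_order yn y0.
rewrite vv vu dv du; case: (leqP k n) => kn.
  exists k; split.
    by rewrite min_l // lee_fin lez_nat ltnS.
  exists v, (t ^+ (n - k) * u); split=> //; last by rewrite v0.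
  by rewrite mulrA -exprD subnKC.
exists n; split; first by rewrite min_r // lee_fin lez_nat ltnS ltnW.
exists (t ^+ (k - n) * v), u; split=> //; last by rewrite u0 orbT.
by rewrite mulrA -exprD subnKC // ltnW.
Qed.

(** For these values q x_j' and q y_j' are regular, so that q f_x and q f_y are
    the product of the slopes with regular functions. *)
Lemma values_above_conductor (n : 'I_p -> nat) :
  value_set (log_residues phi f) [ffun j => (- multiplicity phi j + 1) + (n j)%:Z].
Proof.
have [l f_line] := exists_line curve_neq0.
have [s sP] := slope_exists D_curve D_norm f_line.
(* m j is the multiplicity minus 1, which is the order of the velocity *)
have /choice[m hm] := multiplicityP.
pose q : total_frac R p := [ffun j => tF ^ ((n j)%:Z - (m j)%:Z)].
have tz (k : int) : tF ^ k != 0 by apply: expfz_neq0; exact: tF_neq0.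
have qE j (c : T) : q j * (t ^+ m j * c)%:F = (t ^+ n j * c)%:F.
  rewrite ffunE tFz !tofracM !tofracXn mulrA divfK //.
  by apply: expf_neq0; exact: tF_neq0.
exists q; split.
- apply/log_residuesP.
  have /choice[a ha] := fun j => (hm j).2.
  have /choice[b hb] := ha.
  have [B eB] := slope_in_OD D_curve D_norm f_line sP (fun j => t ^+ n j * a j).
  have [A eA] := slope_in_OD D_curve D_norm f_line sP (fun j => - (t ^+ n j * b j)).
  exists A, B => j; have [_ ey ex] := sP j; have [da db _] := hb j.
  rewrite -eA -eB ex ey da db tofracN -!qE.
  by split; ring.
- move=> r e; apply/ffunP => j; have := congr1 (fun g : total_frac R p => g j) e.
  rewrite !ffunE => /eqP; rewrite mulf_eq0 => /orP[/eqP e0|/eqP //].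
  by have := tz ((n j)%:Z - (m j)%:Z); rewrite e0 eqxx.
move=> j; rewrite !ffunE (hm j).1 -[tF ^ _]mulr1 -tofrac1 val_tE.
  by congr (_%:E); rewrite -addn1 PoszD; ring.
by rewrite cps1_1 oner_neq0.
Qed.

(** Elements of O_D have total residue 0, but here a single branch contributes,
    and its contribution is a nonzero multiple of u(0). *)
Lemma no_isolated_pole l (f_line : line l f != 0) (s : 'I_p -> QT) i (c : 'I_p -> QT)
    (u : T) h :
  is_slope f phi s ->
  u 0%N != 0 -> c i = u%:F / tF -> (forall j, j != i -> exists a : T, c j = a%:F) ->
  ~ (forall j, s j * c j = (phi j h)%:F).
Proof.
move=> sP u0 ci cj hc.
have e : curve_residue D_norm f_line [ffun j => s j * c j] = 0.
  by apply: (@curve_residue_pullback _ _ _ _ _ D_norm _ f_line _ h) => j; rewrite ffunE hc.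
move: e; rewrite curve_residue_slope_sum (bigD1 i) //= big1; last first.
  by move=> j /cj[a ->]; exact: (branch_residue_tofrac D_norm f_line sP).
rewrite addr0 ci {1}(tshiftE u) tofracD mulrDl branch_residueD branch_residue_scale.
have -> : (t * tshift u)%:F / tF = (tshift u)%:F.
  by rewrite tofracM mulrAC (mulfV (tF_neq0 R)) mul1r.
rewrite (branch_residue_tofrac D_norm f_line sP) addr0 => /eqP; rewrite mulf_eq0 (negPf u0) /=.
by rewrite (negPf (branch_residue_simple_pole D_curve D_norm f_line sP i)).
Qed.

(** Otherwise some residue q has the value - multiplicity phi i on D_i and
    nonnegative values elsewhere.  The component of the velocity of minimal
    order on D_i turns the pole of q into a simple one. *)
Lemma conductor_below_values (mu : {ffun 'I_p -> int}) :
  (forall n : 'I_p -> nat,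
     value_set (log_residues phi f) [ffun i => mu i + (n i)%:Z]) ->
  forall i, - multiplicity phi i + 1 <= mu i.
Proof.
move=> above i; have [l f_line] := exists_line curve_neq0.
have [s sP] := slope_exists D_curve D_norm f_line.
have [m [em [a [b [ea eb ab]]]]] := multiplicityP i.
rewrite leNgt; apply/negP => lt.
(* n moves mu to the value - (m + 1) on D_i, and to a value >= 0 elsewhere *)
pose n j : nat := if j == i then absz (mu i + m.+1%:Z) else absz (mu j).
have [q [/log_residuesP[A [B AB]] _ vq]] := above n.
have qj j : j != i -> exists c : T, q j = c%:F.
  move=> ji; apply: (val_t_ge0 (vq j)); rewrite ffunE /n (negPf ji); lia.
have [v [w [w0 eq]]] := frac_order (val_t_neq0 (vq i)).
have ev : v = - m.+1%:Z.
  move: (vq i); rewrite eq val_tE // ffunE /n eqxx => -[->].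
  by move: lt; rewrite em; lia.
have tm0 : tF ^+ m != 0 by apply: expf_neq0; exact: tF_neq0.
have polar (c : T) : q i * (t ^+ m * c)%:F = (w * c)%:F / tF.
  rewrite eq ev -exprnN exprSr invfM !tofracM tofracXn.
  have e (k1 k2 k3 k4 k5 : QT) : k1 * k2 * k3 * (k4 * k5) = k1 * k4 * (k3 * k5 * k2).
    ring.
  by rewrite e (mulVf tm0) mul1r.
have unit0 (c : T) : c 0%N != 0 -> (w * c) 0%N != 0.
  by move=> c0; rewrite cps1_M fpsM0E mulf_neq0.
case/orP: ab => [a0|b0].
  apply: (@no_isolated_pole _ f_line s i (fun j => q j * (tder (phi j x))%:F) (w * a) B sP).
  - exact: unit0.
  - by rewrite ea polar.
  - by move=> j /qj[c ->]; exists (c * tder (phi j x)); rewrite tofracM.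
  by move=> j; have [_ ey _] := sP j; rewrite -(AB j).2 ey mulrCA.
apply: (@no_isolated_pole _ f_line s i (fun j => q j * (- tder (phi j y))%:F) (w * - b) A sP).
- by apply: unit0; rewrite cps1_N fpsNE oppr_eq0.
- by rewrite eb -mulrN polar.
- by move=> j /qj[c ->]; exists (c * - tder (phi j y)); rewrite tofracM.
by move=> j; have [_ _ ex] := sP j; rewrite -(AB j).1 ex tofracN; ring.
Qed.

End LogarithmicResidues.

Theorem proposition3p21 (R : realType) (p : nat)
    (f : cps2 R) (fs : 'I_p -> cps2 R)
    (phi : 'I_p -> {rmorphism cps2 R -> cps1 R})
    (D_curve : reduced_curve f fs)
    (D_normalization : normalization phi f fs) :
  is_conductor (value_set (log_residues phi f))
    [ffun j => - multiplicity phi j + 1].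
Proof.
split=> [n|mu above i].
  have -> : [ffun i => [ffun j => - multiplicity phi j + 1] i + (n i)%:Z] =
            [ffun j => (- multiplicity phi j + 1) + (n j)%:Z] :> {ffun 'I_p -> int}.
    by apply/ffunP => i; rewrite !ffunE.
  exact: values_above_conductor D_curve D_normalization n.
rewrite ffunE; exact: conductor_below_values D_curve D_normalization mu above i.
Qed.
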